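(* Let $l$ and $m$ be positive integers and $N = m^{l+1}-1$. The projective variety $\overline{{\rm MTD}}_{l,m} \subset \mathbb{P}^N$ is a cone with base (vertex) a linear space $\mathbb{P}^{m-1}$ over the Segre variety $\mathbb{P}^{l-1} \times \mathbb{P}^{m^2-2m}$. If $m \geq 3$, then this variety is singular and its singular locus is the $\mathbb{P}^{m-1}$ that forms the base of that cone. The degree of $\overline{{\rm MTD}}_{l,m}$ equals $$\binom{l+(m-1)^2-2}{l-1}.$$
   Context: Fix positive integers $l$ and $m$, set $N = m^{l+1}-1$ and $[m]=\{1,\ldots,m\}$. Write $\Delta_k$ for the standard $k$-dimensional probability simplex in $\mathbb{R}^{k+1}$. The simplex $\Delta_N$ has coordinates $p_{i_0 i_1 \cdots i_l}$ indexed by sequences $i_0 i_1\cdots i_l \in [m]^{l+1}$; the same $p_{i_0\cdots i_l}$ serve as homogeneous coordinates on the complex projective space $\mathbb{P}^N$, and $\Delta_N$ is regarded as a subset of $\mathbb{P}^N$ via these coordinates. The model ${\rm MTD}_{l,m}$ is the image of the map $\phi_{l,m} : (\Delta_{m-1})^m \times \Delta_{l-1} \to \Delta_N$ whose input is an $m\times m$ transition matrix $(q_{ij})$ (non-negative entries, each row summing to $1$) together with a probability distribution $\lambda=(\lambda_1,\ldots,\lambda_l)$, and which is given by $$ p_{i_0 i_1 \cdots i_{l-1} i_l} = \frac{1}{m^l} \sum_{j=1}^{l} \lambda_j\, q_{i_{j-1},\, i_l}. $$ $\overline{{\rm MTD}}_{l,m}$ denotes the Zariski closure of ${\rm MTD}_{l,m}$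 in $\mathbb{P}^N$. The Segre variety $\mathbb{P}^{l-1} \times \mathbb{P}^{m^2-2m}$ is taken in its Segre embedding as the variety of $l\times (m-1)^2$ matrices of rank one in $\mathbb{P}^{l(m-1)^2-1}$. A cone ''with base $\mathbb{P}^{m-1}$'' over a projective variety $X$ means the join of $X$ (embedded in a linear subspace of $\mathbb{P}^N$) with a linear subspace $\mathbb{P}^{m-1}\subset\mathbb{P}^N$ disjoint from the linear span of $X$; this $\mathbb{P}^{m-1}$ is the vertex set of the cone.
   Formalization: The singular-locus claim is stated for l ≥ 2 (for l = 1 the cone is a linear space, hence smooth), and the degree formula for m ≥ 2 or l = 1 (for m = 1, l ≥ 2 the variety is a point of degree 1 while the binomial coefficient is 0). *)

(* Defs.v *)
From mathcomp Require Export all_boot all_order all_algebra.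
From mathcomp Require Export classical_sets reals.
From mathcomp Require Export complex mpoly.

Set Implicit Arguments.
Unset Strict Implicit.
Unset Printing Implicit Defensive.

Import GRing.Theory.

Local Open Scope classical_set_scope.
Local Open Scope ring_scope.

(* A subset of the projective space P(V) is represented by the set of all
   homogeneous coordinate vectors of its points: nonzero vectors of V, stable
   under multiplication by nonzero scalars. *)

Section ProjectiveGeometry.
Variable F : fieldType.

Section Subspaces.
Variable V : vectType F.

Definition proj_linear (L : {vspace V}) : set V := [set v | v != 0 /\ v \in L].

Definition lin_span (X : set V) : set V :=
  [set v | forall U : {vspace V}, (forall x, X x -> x \in U) -> v \in U].

(* The union of the lines through a point of X and a point of P(L), together
   with X and P(L).  For X closed and P(L) disjoint from the span of X, this set
   is already Zariski closed, so that no closure is taken.  If X is empty, it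
   is P(L). *)
Definition join_linear (X : set V) (L : {vspace V}) : set V :=
  [set v | v != 0 /\
     exists x y, [/\ X x \/ x = 0, y \in L & v = x + y]].

Definition is_cone (X : set V) (L : {vspace V}) (Y : set V) : Prop :=
  (forall v, lin_span X v -> v \in L -> v = 0) /\ Y = join_linear X L.

Definition has_vdim (S : set V) (k : nat) : Prop :=
  exists2 U : {vspace V}, S = [set v | v \in U] & \dim U = k.

End Subspaces.

(* P^(a-1) x P^(b-1) in P^(ab-1); it is empty when a = 0 or b = 0. *)
Definition segre (a b : nat) : set 'M[F]_(a, b) := [set M | \rank M = 1%N].

Variable n : nat.
Implicit Type X : set 'rV[F]_n.

(* The degree t part of the homogeneous vanishing ideal of X. *)
Definition van_forms X (t : nat) : set {mpoly F[n]} :=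
  [set f | f \is t.-homog /\ forall x, X x -> f.@[x ord0] = 0].

Definition zariski_closure X : set 'rV[F]_n :=
  [set x : 'rV[F]_n | x != 0 /\ forall t f, van_forms X t f -> f.@[x ord0] = 0].

(* k is the dimension of (F[x_1..x_n] / I(X))_t: the family b is a basis of the
   space of forms of degree t modulo I(X)_t. *)
Definition hilbert_function X (t k : nat) : Prop :=
  exists b : 'I_k -> {mpoly F[n]},
    [/\ forall i, b i \is t.-homog,
        forall c : 'I_k -> F,
          van_forms X t (\sum_i c i *: b i) -> forall i, c i = 0
      & forall f : {mpoly F[n]}, f \is t.-homog ->
          exists c : 'I_k -> F, van_forms X t (f - \sum_i c i *: b i)].

Definition hilbert_polynomial X (P : {poly rat}) : Prop :=
  exists t0 : nat, forall t, (t0 <= t)%N ->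
    exists2 k : nat, hilbert_function X t k & P.[t%:R] = k%:R.

(* The dimension d as a projective variety; no d exists if X is empty. *)
Definition proj_dim X (d : nat) : Prop :=
  exists2 P : {poly rat}, hilbert_polynomial X P & size P = d.+1.

(* The Hilbert polynomial has leading term (e / d!) t^d, where d = dim X. *)
Definition proj_degree X (e : nat) : Prop :=
  exists P : {poly rat}, exists d : nat,
    [/\ hilbert_polynomial X P, size P = d.+1
      & lead_coef P = e%:R / d`!%:R].

(* The linear space in F^n whose projectivization is the embedded projective
   tangent space of X at x. *)
Definition tangent_space X (x : 'rV[F]_n) : set 'rV[F]_n :=
  [set v | forall t (f : {mpoly F[n]}), van_forms X t f ->
     \sum_(i < n) v ord0 i * (f^`M(i)).@[x ord0] = 0].

(* Meant for X closed and irreducible, where the local dimension of X is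
   everywhere equal to dim X.  The space [tangent_space X x] and the affine cone
   over X have dimensions one more than their projectivizations. *)
Definition singular_locus X : set 'rV[F]_n :=
  [set x | X x /\ exists d k,
     [/\ proj_dim X d, has_vdim (tangent_space X x) k & (d.+1 < k)%N]].

End ProjectiveGeometry.

Arguments segre : clear implicits.

Section MixtureTransitionDistribution.
Variables (R : realType) (l m : nat).

(* The sequences i_0 i_1 .. i_l in [m]^(l+1), with [m] = {0, .., m-1}. *)
Definition mtd_index : finType := (l.+1).-tuple 'I_m.

(* N + 1; the homogeneous coordinates of P^N are numbered along the standard
   enumeration of mtd_index. *)
Definition mtd_ncoord : nat := #|mtd_index|.

Lemma mtd_ncoordE : mtd_ncoord = (m ^ l.+1)%N.
Proof. by rewrite /mtd_ncoord card_tuple card_ord. Qed.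

(* The standard simplex of dimension k - 1. *)
Definition simplex (k : nat) : set 'rV[R]_k :=
  [set p | (forall i, 0 <= p ord0 i) /\ \sum_i p ord0 i = 1].

Definition transition_matrices : set 'M[R]_m :=
  [set q | forall i, simplex (row i q)].

(* lam ord0 j is lambda_(j+1), which is why it comes with the row i_j. *)
Definition mtd_map (q : 'M[R]_m) (lam : 'rV[R]_l) : 'rV[R]_mtd_ncoord :=
  \row_k let i : mtd_index := enum_val k in
    (m ^ l)%:R^-1 *
    \sum_(j < l) lam ord0 j *
      q (tnth i (widen_ord (leqnSn l) j)) (tnth i ord_max).

Definition MTD : set 'rV[R]_mtd_ncoord :=
  [set mtd_map q lam | q in transition_matrices & lam in @simplex l].

Definition MTD_proj : set 'rV[R[i]]_mtd_ncoord :=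
  [set x | exists2 p, MTD p &
     exists2 c : R[i], c != 0 & x = c *: map_mx (real_complex R) p].

Definition MTD_bar : set 'rV[R[i]]_mtd_ncoord := zariski_closure MTD_proj.

End MixtureTransitionDistribution.

Arguments MTD : clear implicits.
Arguments MTD_proj : clear implicits.
Arguments MTD_bar : clear implicits.

(* Main.v *)
(* Subtracting the last row of the transition matrix from the others splits a
   point of the model as f (u *m w) + g y, where g y depends only on the last
   letter i_l, u is lambda, w collects the (m-1)^2 free entries of the matrix of
   row differences, and f and g are linear, injective and have independent images.
   The points of this form with complex u, w, y make up the cone over the Segre
   variety with vertex P(im g).  It is cut out by linear forms and the 2 x 2
   minors, and it is in the Zariski closure because a polynomial that vanishes at
   the admissible real parameters vanishes at all complex ones.
   Its degree t coordinate ring has a basis of monomials in u, w, y of degrees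
   (s, s, t - s), and summing over s gives the Hilbert polynomial.  At a vertex
   every rank one direction is tangent, so the tangent space is im f + im g; away
   from the vertex the differentials of the minors cut the tangent space down to
   the dimension of the cone. *)

From HB Require Import structures.
Require Import Defs.
From mathcomp Require Import zify ring lra.

Set Implicit Arguments.
Unset Strict Implicit.
Unset Printing Implicit Defensive.

Import Order.TTheory GRing.Theory Num.Theory.

Local Open Scope classical_set_scope.
Local Open Scope ring_scope.

(** * Summation of polynomial sequences *)

(** Coefficient comparison in the product of [(1-x)^-(n+1)] and [(1-x)^-(k+1)]. The double induction
    uses Pascal's rule on the second factor. *)
Lemma sum_bin_conv (n k t : nat) :
  (\sum_(s < t.+1) 'C(s + n, n) * 'C(t - s + k, k) = 'C(t + n + k.+1, n + k.+1))%N.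
Proof.
elim: k n t => [|k IHk] n t.
  under eq_bigr do rewrite bin0 muln1.
  elim: t => [|t IHt]; first by rewrite big_ord_recl big_ord0 !add0n !binn.
  by rewrite big_ord_recr /= IHt !addn1 !addSn -binS.
elim: t => [|t IHt].
  by rewrite big_ord_recl big_ord0 subn0 !add0n !binn.
rewrite big_ord_recr /= subnn add0n binn muln1.
have E (s : 'I_t.+1) : true ->
    ('C(s + n, n) * 'C(t.+1 - s + k.+1, k.+1) =
     'C(s + n, n) * 'C(t - s + k.+1, k.+1) + 'C(s + n, n) * 'C(t.+1 - s + k, k))%N.
  move=> _; rewrite subSn; last by rewrite -ltnS.
  by rewrite !addSn !addnS binS mulnDr.
rewrite (eq_bigr _ E) big_split /= IHt -addnA.
have := IHk n t.+1; rewrite big_ord_recr /= subnn add0n binn muln1 => ->.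
by rewrite !addSn !addnS [in RHS]binS.
Qed.

Section BinomialPolynomials.
Variable F : numFieldType.
Implicit Types (n k : nat) (A : {poly F}).

(** The polynomial [t |-> 'C(t + n, n)], as a scaled product of monic linear factors, which makes
    its degree and leading coefficient immediate. *)
Definition bin_poly n : {poly F} :=
  n`!%:R^-1 *: \prod_(i < n) ('X - (- i.+1%:R)%:P).

Lemma bin_polyE n t : (bin_poly n).[t%:R] = 'C(t + n, n)%:R.
Proof.
rewrite /bin_poly hornerZ horner_prod.
have -> : \prod_(i < n) ('X - (- i.+1%:R : F)%:P).[t%:R]
    = ('C(t + n, n) * n`!)%:R :> F.
  rewrite bin_ffact; elim: n => [|n IHn]; first by rewrite big_ord0 ffactn0.
  rewrite big_ord_recr /= IHn addnS ffactSS !hornerE.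
  by rewrite opprK -natrD mulrC -natrM addnS.
by rewrite natrM mulrC mulfK // pnatr_eq0 -lt0n fact_gt0.
Qed.

Lemma size_bin_poly n : size (bin_poly n) = n.+1.
Proof.
rewrite size_scale ?size_prod_XsubC ?/index_enum -?enumT ?size_enum_ord //.
by rewrite invr_eq0 pnatr_eq0 -lt0n fact_gt0.
Qed.

Lemma lead_bin_poly n : lead_coef (bin_poly n) = n`!%:R^-1.
Proof. by rewrite lead_coefZ lead_coef_prod big1 ?mulr1 // => i _; rewrite lead_coefXsubC. Qed.

Lemma coef_bin_poly n : (bin_poly n)`_n = n`!%:R^-1.
Proof. by rewrite -lead_bin_poly lead_coefE size_bin_poly. Qed.

(** On [bin_poly D] the convolution is [sum_bin_conv] and yields [bin_poly (D + k.+1)]; a general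
    [A] differs from a multiple of [bin_poly D] by lower degree. This is the passage from a Hilbert
    polynomial to that of a cone. *)
Lemma sum_poly_bin D A k : size A = D.+1 ->
  exists Q : {poly F}, [/\ size Q = (D + k.+1).+1,
    lead_coef Q = lead_coef A * D`!%:R / (D + k.+1)`!%:R &
    forall t : nat, Q.[t%:R] =
      \sum_(s < t.+1) A.[s%:R] * 'C(t - s + k, k)%:R].
Proof.
move=> sA.
(* What remains after cancelling the leading term may have any lower degree, so the induction only
   bounds the size of [Q]. *)
suff weak : forall n A, (size A <= n)%N -> exists Q : {poly F},
    (size Q <= n + k.+1)%N /\ forall t : nat, Q.[t%:R] =
      \sum_(s < t.+1) A.[s%:R] * 'C(t - s + k, k)%:R.
  pose a := lead_coef A * D`!%:R; pose A' := A - a *: bin_poly D.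
  have a0 : a != 0.
    rewrite mulf_neq0 ?lead_coef_eq0 -?size_poly_eq0 ?sA //.
    by rewrite pnatr_eq0 -lt0n fact_gt0.
  have sA' : (size A' <= D)%N.
    apply/leq_sizeP => j; rewrite leq_eqVlt => /orP[/eqP<-|Dj].
      rewrite coefB coefZ.
      by rewrite coef_bin_poly /a lead_coefE sA mulfK ?subrr // pnatr_eq0 -lt0n fact_gt0.
    by rewrite coefB coefZ !nth_default ?mulr0 ?subr0 ?size_bin_poly ?sA.
  have [Q' [sQ' hQ']] := weak _ _ sA'.
  have sB : size (a *: bin_poly (D + k.+1)) = (D + k.+1).+1.
    by rewrite size_scale ?size_bin_poly.
  exists (a *: bin_poly (D + k.+1) + Q'); split.
  - by rewrite size_polyDl sB // ltnS.
  - by rewrite lead_coefDl ?sB ?ltnS // lead_coefZ lead_bin_poly.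
  - move=> t; rewrite hornerD hQ' hornerZ bin_polyE addnA -sum_bin_conv.
    rewrite natr_sum mulr_sumr -big_split /=; apply: eq_bigr => s _.
    by rewrite /A' hornerD hornerN hornerZ bin_polyE natrM; ring.
elim=> [|n IHn] {sA D}A sA.
  move: sA; rewrite leqn0 size_poly_eq0 => /eqP->; exists 0; split.
    by rewrite size_poly0.
  by move=> t; rewrite horner0 big1 // => s _; rewrite horner0 mul0r.
pose a := A`_n * n`!%:R; pose A' := A - a *: bin_poly n.
have sA' : (size A' <= n)%N.
  apply/leq_sizeP => j; rewrite leq_eqVlt => /orP[/eqP<-|Dj].
    rewrite coefB coefZ.
    by rewrite coef_bin_poly /a mulfK ?subrr // pnatr_eq0 -lt0n fact_gt0.
  rewrite coefB coefZ !nth_default ?mulr0 ?subr0 ?size_bin_poly //.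
  exact: leq_trans sA Dj.
have [Q' [sQ' hQ']] := IHn _ sA'.
exists (a *: bin_poly (n + k.+1) + Q'); split.
  apply: leq_trans (size_polyD _ _) _; rewrite geq_max addSn.
  rewrite (leq_trans (size_scale_leq _ _)) ?size_bin_poly //=.
  exact: leq_trans sQ' (leqnSn _).
move=> t; rewrite hornerD hQ' hornerZ bin_polyE addnA -sum_bin_conv.
rewrite natr_sum mulr_sumr -big_split /=; apply: eq_bigr => s _.
by rewrite /A' hornerD hornerN hornerZ bin_polyE natrM; ring.
Qed.

End BinomialPolynomials.

(** * Polynomials along lines *)

Lemma mpoly_alg_ind (n : nat) (R : nzRingType) (P : {mpoly R[n]} -> Prop) :
  (forall c, P c%:MP) -> (forall i, P 'X_i) ->
  (forall p q, P p -> P q -> P (p + q)) ->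
  (forall p q, P p -> P q -> P (p * q)) -> forall p, P p.
Proof.
move=> PC PX PD PM p; elim/mpolyind: p => [|c u p _ _ Pp].
  by rewrite -mpolyC0.
apply: PD => //; rewrite -mul_mpolyC; apply: (PM) => //.
rewrite mpolyXE_id; apply: big_ind; [by rewrite -mpolyC1 | exact: PM |].
by move=> i _; elim: (u i) => [|k IHk]; [rewrite expr0 -mpolyC1 | rewrite exprS; apply: PM].
Qed.

Section PolynomialCurves.
Variables (F : fieldType) (n : nat).
Implicit Types (h p q : {mpoly F[n]}) (x v : 'I_n -> F).

Lemma meval_curve (c : 'I_n -> {poly F}) h :
  exists p : {poly F}, forall t, p.[t] = h.@[fun k => (c k).[t]].
Proof.
elim/mpoly_alg_ind: h => [a|i|h1 h2 [p1 e1] [p2 e2]|h1 h2 [p1 e1] [p2 e2]].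
- by exists a%:P => t; rewrite hornerC mevalC.
- by exists (c i) => t; rewrite mevalXU.
- by exists (p1 + p2) => t; rewrite hornerD mevalD e1 e2.
- by exists (p1 * p2) => t; rewrite hornerM mevalM e1 e2.
Qed.

(** The expression that defines [tangent_space], named so that the rules of calculus apply to it. *)
Definition dir_deriv v x h : F := \sum_(i < n) v i * (h^`M(i)).@[x].

Lemma dir_derivD v x p q : dir_deriv v x (p + q) = dir_deriv v x p + dir_deriv v x q.
Proof. by rewrite -big_split; apply: eq_bigr => i _; rewrite mderivD mevalD mulrDr. Qed.

Lemma dir_derivC v x a : dir_deriv v x a%:MP = 0.
Proof. by rewrite /dir_deriv big1 // => i _; rewrite mderivC meval0 mulr0. Qed.

Lemma dir_derivN v x p : dir_deriv v x (- p) = - dir_deriv v x p.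
Proof. by rewrite /dir_deriv -sumrN; apply: eq_bigr => i _; rewrite mderivN mevalN mulrN. Qed.

Lemma dir_derivM v x p q :
  dir_deriv v x (p * q) = dir_deriv v x p * q.@[x] + p.@[x] * dir_deriv v x q.
Proof.
rewrite /dir_deriv mulr_suml mulr_sumr -big_split; apply: eq_bigr => i _.
by rewrite mderivM mevalD !mevalM mulrDr mulrA; congr (_ + _); rewrite mulrCA.
Qed.

Lemma dir_derivXU v x i : dir_deriv v x 'X_i = v i.
Proof.
rewrite /dir_deriv (bigD1 i) //= big1 ?addr0 => [|j ji].
  by rewrite mderivX mnm1E eqxx scale1r -[X in 'X_[X - _]]add0m addmK mpolyX0 meval1 mulr1.
by rewrite mderivX mnm1E eq_sym (negPf ji) scale0r meval0 mulr0.
Qed.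

(** Only the linear coefficient is named; all higher terms are absorbed in [q]. Such expansions are
    stable under sums and products. *)
Lemma meval_taylor v x h : exists q : {poly F}, forall t,
  h.@[fun k => x k + t * v k] = h.@[x] + t * dir_deriv v x h + t ^+ 2 * q.[t].
Proof.
elim/mpoly_alg_ind: h => [a|i|h1 h2 [q1 e1] [q2 e2]|h1 h2 [q1 e1] [q2 e2]].
- by exists 0 => t; rewrite !mevalC dir_derivC horner0; ring.
- by exists 0 => t; rewrite !mevalXU dir_derivXU horner0; ring.
- by exists (q1 + q2) => t; rewrite !mevalD e1 e2 dir_derivD hornerD; ring.
- pose d1 := dir_deriv v x h1; pose d2 := dir_deriv v x h2.
  exists ((d1 * d2)%:P + h1.@[x] *: q2 + h2.@[x] *: q1 + d1 *: 'X * q2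
    + d2 *: 'X * q1 + 'X^2 * q1 * q2) => t.
  rewrite !mevalM e1 e2 dir_derivM -/d1 -/d2 !hornerE.
  ring.
Qed.

Definition lin_mpoly (phi : 'rV[F]_n -> F) : {mpoly F[n]} :=
  \sum_k phi (delta_mx 0 k) *: 'X_k.

Lemma lin_mpoly_homog phi : lin_mpoly phi \is 1.-homog.
Proof.
by apply: rpred_sum => k _; apply: rpredZ; rewrite dhomogX /= mdeg1.
Qed.

Lemma meval_lin_mpoly (phi : 'rV[F]_n -> F) (x : 'rV_n) :
  scalar phi -> (lin_mpoly phi).@[x ord0] = phi x.
Proof.
move=> lin_phi.
pose psi : {scalar _} := HB.pack phi (GRing.isLinear.Build _ _ _ _ phi lin_phi).
rewrite -[phi]/(psi : _ -> _) [in RHS](row_sum_delta x) linear_sum raddf_sum.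
by apply: eq_bigr => k _; rewrite [RHS](scalarZ psi) [LHS]mevalZ mevalXU mulrC.
Qed.

Lemma dir_deriv_lin_mpoly (phi : 'rV[F]_n -> F) (x v : 'rV_n) :
  scalar phi -> dir_deriv (v ord0) (x ord0) (lin_mpoly phi) = phi v.
Proof.
move=> lin_phi.
pose psi : {scalar _} := HB.pack phi (GRing.isLinear.Build _ _ _ _ phi lin_phi).
rewrite -[phi]/(psi : _ -> _) [in RHS](row_sum_delta v) linear_sum.
rewrite /lin_mpoly (big_morph _ (dir_derivD _ _) (dir_derivC _ _ 0)).
apply: eq_bigr => k _.
rewrite [RHS](scalarZ psi) -mul_mpolyC dir_derivM dir_derivC mul0r add0r mevalC dir_derivXU.
by rewrite mulrC.
Qed.

End PolynomialCurves.

(** In characteristic 0 the large naturals supply more distinct roots than the degree allows. This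
    is the density argument used throughout. *)
Lemma poly_eq0_on_nat (F : numFieldType) (p : {poly F}) (N : nat) :
  (forall k : nat, (N <= k)%N -> p.[k%:R] = 0) -> p = 0.
Proof.
move=> p0; apply/eqP; apply: contraT => pN0.
pose s := [seq (k%:R : F) | k <- iota N (size p)].
have : (size s < size p)%N.
  apply: max_poly_roots => //; last first.
    by rewrite map_inj_uniq ?iota_uniq // => i j /eqP; rewrite eqr_nat => /eqP.
  by apply/allP => x /mapP[k]; rewrite mem_iota => /andP[Nk _] ->; rewrite rootE p0.
by rewrite size_map size_iota ltnn.
Qed.

(** * Uniqueness of the Hilbert function and the Hilbert polynomial *)

Section HilbertUniqueness.
Variables (F : fieldType) (n : nat).
Implicit Type X : set 'rV[F]_n.

Lemma van_forms_lin X t (a : F) (p q : {mpoly F[n]}) :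
  van_forms X t p -> van_forms X t q -> van_forms X t (a *: p + q).
Proof.
move=> [hp vp] [hq vq]; split=> [|x Xx]; first by rewrite rpredD // rpredZ.
by rewrite mevalD mevalZ vp // vq // mulr0 addr0.
Qed.

Lemma van_forms0 X t : van_forms X t 0.
Proof. by split=> [|x _]; rewrite ?rpred0 // meval0. Qed.

Lemma van_forms_sum X t (I : Type) (r : seq I) (a : I -> F) (p : I -> {mpoly F[n]}) :
  (forall i, van_forms X t (p i)) -> van_forms X t (\sum_(i <- r) a i *: p i).
Proof.
move=> vp; elim: r => [|i r IHr]; first by rewrite big_nil; exact: van_forms0.
by rewrite big_cons; apply: van_forms_lin.
Qed.

(** Writing [b] in terms of [b'] modulo vanishing forms gives a matrix [M]. A relation among its
    rows is a relation among the [b i] modulo vanishing forms, so [M] has full row rank. *)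
Lemma hilbert_function_le X t k k' :
  hilbert_function X t k -> hilbert_function X t k' -> (k <= k')%N.
Proof.
move=> [b [hb indb _]] [b' [hb' _ spanb']].
pose C (i : 'I_k) := sval (boolp.cid (spanb' (b i) (hb i))).
have CP i : van_forms X t (b i - \sum_j C i j *: b' j).
  exact: (svalP (boolp.cid (spanb' (b i) (hb i)))).
pose M := \matrix_(i, j) C i j.
suff: row_free M by rewrite /row_free => /eqP <-; exact: rank_leq_col.
rewrite -kermx_eq0; apply/eqP/row_matrixP => r; rewrite row0.
set u := row r _; have uM : u *m M = 0 by apply/sub_kermxP/row_sub.
apply/rowP => i; rewrite [RHS]mxE; apply: (indb (u ord0)) => //.
have := @van_forms_sum X t _ (index_enum 'I_k) (u ord0) _ CP.
congr (van_forms X t _).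
rewrite (eq_bigr _ (fun i _ => scalerBr _ _ _)) sumrB.
rewrite [X in _ - X](_ : _ = 0) ?subr0 //.
under eq_bigr do rewrite scaler_sumr.
rewrite exchange_big /= big1 // => j _.
under eq_bigr do rewrite scalerA.
rewrite -scaler_suml.
have /rowP/(_ j) := uM; rewrite !mxE => uMj.
rewrite (_ : \sum_i _ = 0) ?scale0r // -[RHS]uMj; apply: eq_bigr => q _.
by rewrite !mxE.
Qed.

Lemma hilbert_function_uniq X t k k' :
  hilbert_function X t k -> hilbert_function X t k' -> k = k'.
Proof.
by move=> h h'; apply/eqP; rewrite eqn_leq !(hilbert_function_le _ h') ?(hilbert_function_le _ h).
Qed.

Lemma hilbert_polynomial_uniq X P P' :
  hilbert_polynomial X P -> hilbert_polynomial X P' -> P = P'.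
Proof.
move=> [t0 hP] [t1 hP']; apply/eqP; rewrite -subr_eq0; apply/eqP.
apply: (@poly_eq0_on_nat _ _ (maxn t0 t1)) => t; rewrite geq_max => /andP[t0t t1t].
have [k hk ek] := hP t t0t; have [k' hk' ek'] := hP' t t1t.
by rewrite hornerD hornerN ek ek' (hilbert_function_uniq hk hk') subrr.
Qed.

End HilbertUniqueness.

(** * Hilbert function of the cone *)

(** The multiplicity of [x] is the digit of the sum at [D ^ x], and the size bounds keep digits
    below [D]. The induction is on a bound for the entries and strips the lowest digit. *)
Lemma sum_expn_inj (D : nat) (s1 s2 : seq nat) : (size s1 < D)%N -> (size s2 < D)%N ->
  (\sum_(x <- s1) D ^ x = \sum_(x <- s2) D ^ x)%N -> perm_eq s1 s2.
Proof.
pose N := (\max_(x <- s1 ++ s2) x).+1.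
have bound s x : {subset s <= s1 ++ s2} -> x \in s -> (x < N)%N.
  by move=> sub /sub xs; rewrite ltnS (leq_bigmax_seq x).
have : all (fun x => (x < N)%N) s2.
  by apply/allP => x; apply: bound => y ys; rewrite mem_cat ys orbT.
have : all (fun x => (x < N)%N) s1.
  by apply/allP => x; apply: bound => y ys; rewrite mem_cat ys.
move: N {bound} => N; elim: N s1 s2 => [|N IHN] s1 s2.
  by case: s1 => [|x s1]; case: s2 => [|y s2].
move=> a1 a2 z1 z2.
(* Dropping the zeros and shifting the other entries down removes the last digit of the number in
   base [D]. *)
pose tl (s : seq nat) := [seq x.-1 | x <- s & x != 0%N].
have dec s : perm_eq s (nseq (count_mem 0%N s) 0%N ++ map succn (tl s)).
  have -> : nseq (count_mem 0%N s) 0%N = [seq x <- s | pred1 0%N x].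
    by rewrite -size_filter; symmetry; apply/all_pred1P; apply: filter_all.
  have -> : map succn (tl s) = [seq x <- s | predC (pred1 0%N) x].
    rewrite /tl -map_comp -[RHS]map_id; apply/eq_in_map => x.
    by rewrite mem_filter => /andP[/= x0 _]; rewrite prednK // lt0n.
  by rewrite perm_sym perm_filterC.
have sumE s : (\sum_(x <- s) D ^ x = count_mem 0 s + (\sum_(x <- tl s) D ^ x) * D)%N.
  rewrite (perm_big _ (dec s)) big_cat /= big_nseq iter_addn_0 mul1n; congr addn.
  by rewrite big_map big_distrl; apply: eq_bigr => x _; rewrite expnSr.
have tl_size s : (size s < D)%N -> (size (tl s) < D)%N.
  by rewrite size_map size_filter; apply: leq_ltn_trans (count_size _ _).
have tl_all s : all (fun x => (x < N.+1)%N) s -> all (fun x => (x < N)%N) (tl s).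
  move=> /allP h; apply/allP => z /mapP[x]; rewrite mem_filter => /andP[x0 /h xN] ->.
  by rewrite -ltnS prednK ?lt0n.
rewrite (sumE s1) (sumE s2) => E.
have c12 : count_mem 0%N s1 = count_mem 0%N s2.
  have := congr1 (modn^~ D) E; rewrite ![(_ + _ * D)%N]addnC !modnMDl.
  by rewrite !modn_small // (leq_ltn_trans (count_size _ _)).
have D0 : (0 < D)%N by apply: leq_ltn_trans z1.
rewrite (permPl (dec s1)) (permPr (dec s2)) c12 perm_cat2l perm_map //.
apply: IHN; rewrite ?tl_all ?tl_size //.
by move: E; rewrite c12 => /addnI/eqP; rewrite eqn_mul2r gtn_eqF //= => /eqP.
Qed.

(** * Sorted words as indices of monomials *)

Section SortedWords.

(** Sorted words stand for multisets, that is, for the monomials of degree [s] in [n] variables. *)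
Definition sword (s n : nat) : Type :=
  {w : s.-tuple 'I_n | sorted leq (map val w)}.

HB.instance Definition _ s n := Finite.on (sword s n).

Lemma card_sword s n : #|{: sword s n.+1}| = 'C(s + n, n).
Proof.
rewrite card_sig -[RHS]bin_sub ?leq_addl // addnK -card_sorted_tuples.
by apply: eq_card => w; rewrite !inE.
Qed.

Lemma card_sword0 s : #|{: sword s 0}| = (s == 0%N).
Proof.
rewrite card_sig; case: s => [|s] /=.
  rewrite (eq_card (B := predT)) ?card_tuple ?card_ord //.
  by move=> w; rewrite !inE tuple0.
by rewrite eq_card0 // => w; case: (thead w).
Qed.

Lemma card_sword_nil n : #|{: sword 0 n}| = 1%N.
Proof.
rewrite card_sig (eq_card (B := predT)) ?card_tuple ?expn0 // => w.
by rewrite !inE tuple0.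
Qed.

(** Monomials of degrees [(s, s, t - s)] in [u], [w], [y]: each entry of [u *m w] carries one factor
    from [u] and one from [w]. *)
Definition word_index (l b m t : nat) : Type :=
  {s : 'I_t.+1 & (sword s l * sword s b * sword (t - s) m)%type}.

HB.instance Definition _ l b m t := Finite.on (word_index l b m t).

Lemma card_word_index l b m t : #|{: word_index l b m t}| =
  (\sum_(s < t.+1) #|{: sword s l}| * #|{: sword s b}| * #|{: sword (t - s) m}|)%N.
Proof.
rewrite card_tagged sumnE big_map big_enum /=.
by apply: eq_bigr => s _; rewrite !card_prod.
Qed.

Variables l b m t : nat.

Definition word1 (i : word_index l b m t) : seq 'I_l := val (tagged i).1.1.
Definition word2 (i : word_index l b m t) : seq 'I_b := val (tagged i).1.2.
Definition word3 (i : word_index l b m t) : seq 'I_m := val (tagged i).2.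

Lemma word_index_inj (i j : word_index l b m t) :
  perm_eq (word1 i) (word1 j) -> perm_eq (word2 i) (word2 j) ->
  perm_eq (word3 i) (word3 j) -> i = j.
Proof.
have srt n (w w' : seq 'I_n) : sorted leq (map val w) -> sorted leq (map val w') ->
    perm_eq w w' -> w = w'.
  move=> sw sw' /(perm_map val) h; apply: (inj_map val_inj).
  exact: (sorted_eq leq_trans anti_leq).
case: i => s [[[a sa] [b' sb]] [c sc]]; case: j => s' [[[a' sa'] [b'' sb']] [c' sc']].
rewrite /word1 /word2 /word3 /= => h1 h2 h3.
have es : s = s' by apply: val_inj; rewrite /= -(size_tuple a) -(size_tuple a') (perm_size h1).
subst s'; have ea : a = a' by apply: val_inj; apply: srt.
have eb : b' = b'' by apply: val_inj; apply: srt.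
have ec : c = c' by apply: val_inj; apply: srt.
subst; rewrite (bool_irrelevance sa sa') (bool_irrelevance sb sb').
by rewrite (bool_irrelevance sc sc').
Qed.

Lemma word_index_exists (a : seq 'I_l) (c : seq 'I_b) (y : seq 'I_m) :
  size c = size a -> (size a + size y)%N = t ->
  exists i, [/\ perm_eq (word1 i) a, perm_eq (word2 i) c & perm_eq (word3 i) y].
Proof.
move=> sc sy; pose leo n := [rel x y : 'I_n | (x <= y)%N].
have srt n (w : seq 'I_n) : sorted leq (map val (sort (leo n) w)).
  rewrite sorted_map; apply: sort_sorted => x z; exact: leq_total.
have st : (size a < t.+1)%N by rewrite ltnS -sy leq_addr.
have z1 : size (sort (leo l) a) == Ordinal st by rewrite size_sort.
have z2 : size (sort (leo b) c) == Ordinal st by rewrite size_sort sc.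
have z3 : size (sort (leo m) y) == (t - Ordinal st)%N by rewrite size_sort /= -sy addKn.
exists (Tagged (fun s : 'I_t.+1 => (sword s l * sword s b * sword (t - s) m)%type)
  (exist _ (Tuple z1) (srt _ _) : sword (Ordinal st) l,
   exist _ (Tuple z2) (srt _ _) : sword (Ordinal st) b,
   exist _ (Tuple z3) (srt _ _) : sword (t - Ordinal st) m)).
by rewrite /word1 /word2 /word3 /= !perm_sort.
Qed.

Lemma size_word1 i : size (word1 i) = tag i.
Proof. exact: size_tuple. Qed.
Lemma size_word2 i : size (word2 i) = tag i.
Proof. exact: size_tuple. Qed.
Lemma size_word3 i : size (word3 i) = (t - tag i)%N.
Proof. exact: size_tuple. Qed.

(** The three alphabets are shifted to disjoint ranges, so that one multiset of naturals records the
    whole monomial. *)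
Definition word_code i : seq nat :=
  map val (word1 i) ++ map (addn l) (map val (word2 i)) ++
  map (addn (l + b)) (map val (word3 i)).

Lemma size_word_code i : (size (word_code i) <= t.*2)%N.
Proof.
rewrite !size_cat !size_map size_word1 size_word2 size_word3.
have := ltn_ord (tag i); lia.
Qed.

Lemma word_code_inj i j : perm_eq (word_code i) (word_code j) -> i = j.
Proof.
move=> h.
have flt (k : word_index l b m t) :
  [/\ [seq x <- word_code k | x < l]%N = map val (word1 k),
      [seq x <- word_code k | l <= x < l + b]%N = map (addn l) (map val (word2 k)) &
      [seq x <- word_code k | l + b <= x]%N = map (addn (l + b)) (map val (word3 k))].
  have fT (P : pred nat) s : all P s -> filter P s = s by move/all_filterP.
  have fF (P : pred nat) s : all (predC P) s -> filter P s = [::].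
    by rewrite all_predC => /hasPn h'; apply/eqP; rewrite -(negbK (_ == _)) -has_filter; apply/hasPn.
  have a1 x : x \in map val (word1 k) -> (x < l)%N by move=> /mapP[y _ ->]; apply: ltn_ord.
  have a2 x : x \in map (addn l) (map val (word2 k)) -> (l <= x < l + b)%N.
    by move=> /mapP[_ /mapP[y _ ->] ->]; rewrite leq_addr ltn_add2l ltn_ord.
  have a3 x : x \in map (addn (l + b)) (map val (word3 k)) -> (l + b <= x)%N.
    by move=> /mapP[y _ ->]; apply: leq_addr.
  move: a1 a2 a3; rewrite /word_code !filter_cat.
  set s1 := map val (word1 k); set s2 := map (addn l) _; set s3 := map (addn (l + b)) _.
  move=> a1 a2 a3; split.
  - rewrite (fT _ s1) ?(fF _ s2) ?(fF _ s3) ?cats0 //; apply/allP => x.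
    + by move/a3 => /=; lia.
    + by move/a2 => /=; lia.
    + by move/a1.
  - rewrite (fF _ s1) ?(fT _ s2) ?(fF _ s3) ?cats0 //; apply/allP => x.
    + by move/a3 => /=; lia.
    + by move/a2 => /=; lia.
    + by move/a1 => /=; lia.
  - rewrite (fF _ s1) ?(fF _ s2) ?(fT _ s3) //; apply/allP => x.
    + by move/a3 => /=; lia.
    + by move/a2 => /=; lia.
    + by move/a1 => /=; lia.
have [i1 i2 i3] := flt i; have [j1 j2 j3] := flt j.
apply: word_index_inj.
- have := perm_filter (fun x => x < l)%N h.
  by rewrite i1 j1; apply: (perm_map_inj (@ord_inj l)).
- have := perm_filter (fun x => l <= x < l + b)%N h.
  rewrite i2 j2 => /(perm_map_inj (@addnI l)).
  by apply: (perm_map_inj (@ord_inj b)).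
- have := perm_filter (fun x => l + b <= x)%N h.
  rewrite i3 j3 => /(perm_map_inj (@addnI (l + b))).
  by apply: (perm_map_inj (@ord_inj m)).
Qed.

End SortedWords.

(** * Coordinate ring of a cone over a Segre variety, for embeddings [f], [g] with retractions [p1],
    [p2] *)

Section ConeOverSegre.
Variables (F : numFieldType) (l b m n : nat).
Variables (f : {linear 'M[F]_(l, b) -> 'rV[F]_n}) (g : {linear 'rV[F]_m -> 'rV[F]_n}).
Variables (p1 : {linear 'rV[F]_n -> 'M[F]_(l, b)}) (p2 : {linear 'rV[F]_n -> 'rV[F]_m}).
Hypotheses (p1f : cancel f p1) (p1g : forall y, p1 (g y) = 0).
Hypotheses (p2f : forall M, p2 (f M) = 0) (p2g : cancel g p2).

Implicit Types (u : 'cV[F]_l) (w : 'rV[F]_b) (y : 'rV[F]_m).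

Definition cone_point u w y : 'rV[F]_n := f (u *m w) + g y.

(** The products [u *m w] are the matrices of rank at most one; the zero matrix accounts for the
    vertex. *)
Definition segre_cone : set 'rV[F]_n :=
  [set v | v != 0 /\ exists u w y, v = cone_point u w y].

Definition mform (j : 'I_l) (c : 'I_b) : {mpoly F[n]} := lin_mpoly (fun x => p1 x j c).
Definition yform (i : 'I_m) : {mpoly F[n]} := lin_mpoly (fun x => p2 x 0 i).

Lemma p1_scalar j c : scalar (fun x => p1 x j c).
Proof. by move=> a x x'; rewrite linearP !mxE. Qed.
Lemma p2_scalar i : scalar (fun x => p2 x 0 i).
Proof. by move=> a x x'; rewrite linearP !mxE. Qed.

Lemma p1_point u w y : p1 (cone_point u w y) = u *m w.
Proof. by rewrite linearD p1f p1g addr0. Qed.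
Lemma p2_point u w y : p2 (cone_point u w y) = y.
Proof. by rewrite linearD p2f p2g add0r. Qed.

Lemma meval_mform j c (x : 'rV_n) : (mform j c).@[x ord0] = p1 x j c.
Proof. by rewrite meval_lin_mpoly //; exact: p1_scalar. Qed.
Lemma meval_yform i (x : 'rV_n) : (yform i).@[x ord0] = p2 x 0 i.
Proof. by rewrite meval_lin_mpoly //; exact: p2_scalar. Qed.

Definition word_mon (a : seq 'I_l) (c : seq 'I_b) (d : seq 'I_m) u w y : F :=
  (\prod_(j <- a) u j 0) * (\prod_(k <- c) w 0 k) * \prod_(i <- d) y 0 i.

Section FixedDegree.
Variable t : nat.

Definition index_mon (i : word_index l b m t) :=
  word_mon (word1 i) (word2 i) (word3 i).

(** Letters of the first two words are paired by position; any other pairing takes the same values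
    on the cone, where the matrix entries are [u j 0 * w 0 k]. *)
Definition index_form (i : word_index l b m t) : {mpoly F[n]} :=
  (\prod_(q <- zip (word1 i) (word2 i)) mform q.1 q.2) * \prod_(k <- word3 i) yform k.

Lemma index_form_homog i : index_form i \is t.-homog.
Proof.
have prod_homog (T : eqType) (r : seq T) (P : T -> {mpoly F[n]}) :
    (forall q, P q \is 1.-homog) -> \prod_(q <- r) P q \is (size r).-homog.
  move=> h; elim: r => [|q r IHr]; first by rewrite big_nil dhomog1.
  by rewrite big_cons -[size _]/(1 + size r)%N; apply: dhomogM.
have -> : t = (size (zip (word1 i) (word2 i)) + size (word3 i))%N.
  rewrite size1_zip ?size_word1 ?size_word2 ?size_word3 //.
  by have := ltn_ord (tag i); lia.
by apply: dhomogM; apply: prod_homog => q; apply: lin_mpoly_homog.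
Qed.

Lemma meval_index_form i u w y :
  (index_form i).@[cone_point u w y ord0] = index_mon i u w y.
Proof.
rewrite /index_form mevalM !rmorph_prod; congr (_ * _); last first.
  by apply: eq_bigr => k _; rewrite /= meval_yform p2_point.
rewrite (eq_bigr (fun q => u q.1 0 * w 0 q.2)); last first.
  by move=> q _; rewrite /= meval_mform p1_point mxE big_ord1.
rewrite big_split /= -(big_map fst xpredT (fun j => u j 0)).
rewrite -(big_map snd xpredT (fun j => w 0 j)).
by rewrite -/(unzip1 _) -/(unzip2 _) unzip1_zip ?unzip2_zip ?size_word1 ?size_word2.
Qed.

(** Spanning concerns functions of the parameters, so that forms agreeing on the cone are
    identified. *)
Definition mon_span (h : 'cV[F]_l -> 'rV[F]_b -> 'rV[F]_m -> F) : Prop :=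
  exists c : word_index l b m t -> F,
    forall u w y, h u w y = \sum_i c i * index_mon i u w y.

Lemma mon_span_word (a : seq 'I_l) (c : seq 'I_b) (d : seq 'I_m) :
  size c = size a -> (size a + size d)%N = t -> mon_span (word_mon a c d).
Proof.
move=> sc sd; have [i [e1 e2 e3]] := word_index_exists sc sd.
exists (fun k => (k == i)%:R) => u w y.
rewrite (bigD1 i) //= eqxx mul1r big1 ?addr0 => [|k /negPf->]; last by rewrite mul0r.
by rewrite /index_mon /word_mon (perm_big _ e1) (perm_big _ e2) (perm_big _ e3).
Qed.

Lemma mon_span_ext h h' : (forall u w y, h u w y = h' u w y) -> mon_span h -> mon_span h'.
Proof. by move=> e [c hc]; exists c => u w y; rewrite -e. Qed.

Lemma mon_span_sum (I : Type) (r : seq I) (a : I -> F) h :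
  (forall i, mon_span (h i)) -> mon_span (fun u w y => \sum_(i <- r) a i * h i u w y).
Proof.
move=> H; elim: r => [|i r [c hc]].
  exists (fun=> 0) => u w y; rewrite big_nil big1 // => i _; exact: mul0r.
have [c' hc'] := H i; exists (fun k => a i * c' k + c k) => u w y.
rewrite big_cons hc hc' mulr_sumr -big_split; apply: eq_bigr => k _ /=.
by rewrite mulrDl mulrA.
Qed.

End FixedDegree.

(** Concatenating words multiplies monomials and adds degrees; [mon_span_word] then sorts the
    result. *)
Lemma mon_span_mul t t' h h' : mon_span t h -> mon_span t' h' ->
  mon_span (t + t') (fun u w y => h u w y * h' u w y).
Proof.
move=> [c hc] [c' hc'].
apply: (@mon_span_ext _ (fun u w y => \sum_i c i *
    (\sum_j c' j * word_mon (word1 i ++ word1 j) (word2 i ++ word2 j)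
      (word3 i ++ word3 j) u w y))).
  move=> u w y; rewrite hc hc' mulr_suml; apply: eq_bigr => i _.
  rewrite -mulrA; congr (_ * _); rewrite mulr_sumr; apply: eq_bigr => j _.
  rewrite [RHS]mulrCA; congr (_ * _); rewrite /index_mon /word_mon !big_cat /=.
  by rewrite [RHS]mulrACA; congr (_ * _); rewrite [RHS]mulrACA.
apply: mon_span_sum => i; apply: mon_span_sum => j; apply: mon_span_word.
  by rewrite !size_cat !size_word1 !size_word2.
rewrite !size_cat !size_word1 !size_word3.
have := ltn_ord (tag i); have := ltn_ord (tag j); lia.
Qed.

Lemma mon_span1 : mon_span 0 (fun _ _ _ => 1).
Proof.
apply: mon_span_ext (mon_span_word (a := [::]) (c := [::]) (d := [::]) _ _) => //.
by move=> u w y; rewrite /word_mon !big_nil !mulr1.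
Qed.

Lemma mon_span_coord k : mon_span 1 (fun u w y => cone_point u w y 0 k).
Proof.
pose h1 (q : 'I_l * 'I_b) := word_mon [:: q.1] [:: q.2] [::].
pose h2 (i : 'I_m) := word_mon [::] [::] [:: i].
have s1 : mon_span 1 (fun u w y => \sum_(q : 'I_l * 'I_b) f (delta_mx q.1 q.2) 0 k * h1 q u w y).
  by apply: mon_span_sum => q; apply: mon_span_word.
have s2 : mon_span 1 (fun u w y => \sum_(i : 'I_m) g (delta_mx 0 i) 0 k * h2 i u w y).
  by apply: mon_span_sum => q; apply: mon_span_word.
(* The two-element index sequence turns [mon_span_sum] into closure under one addition. *)
have := @mon_span_sum 1 bool [:: true; false] (fun=> 1)
  (fun c => if c then (fun u w y => \sum_(q : 'I_l * 'I_b) f (delta_mx q.1 q.2) 0 k * h1 q u w y)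
   else (fun u w y => \sum_(i : 'I_m) g (delta_mx 0 i) 0 k * h2 i u w y)).
move=> /(_ (fun c => if c as c' return mon_span 1 (if c' then _ else _) then s1 else s2)).
apply: mon_span_ext => u w y.
rewrite !big_cons big_nil !mul1r addr0 /cone_point mxE; congr (_ + _).
  rewrite [u *m w in RHS]matrix_sum_delta pair_bigA linear_sum summxE.
  apply: eq_bigr => q _; rewrite linearZ !mxE big_ord1 /h1 /word_mon.
  by rewrite !big_cons !big_nil !mulr1 mulrC.
rewrite [y in RHS]row_sum_delta linear_sum summxE.
apply: eq_bigr => q _; rewrite linearZ !mxE /h2 /word_mon.
by rewrite !big_cons !big_nil !mulr1 !mul1r mulrC.
Qed.

Lemma mon_span_homog t (h : {mpoly F[n]}) : h \is t.-homog ->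
  mon_span t (fun u w y => h.@[cone_point u w y ord0]).
Proof.
move=> /dhomogP hh.
have prod_span (e : 'X_{1..n}) : mon_span (mdeg e)
    (fun u w y => ('X_[e] : {mpoly F[n]}).@[cone_point u w y ord0]).
  apply: (@mon_span_ext _ (fun u w y => \prod_(i < n) cone_point u w y 0 i ^+ e i)).
    by move=> u w y; rewrite mevalX.
  rewrite mdegE; elim: (index_enum _) => [|i r IHr].
    rewrite big_nil; apply: mon_span_ext mon_span1 => u w y; by rewrite big_nil.
  rewrite big_cons.
  apply: (@mon_span_ext _ (fun u w y => cone_point u w y 0 i ^+ e i *
     \prod_(j <- r) cone_point u w y 0 j ^+ e j)); first by move=> u w y; rewrite big_cons.
  apply: mon_span_mul IHr; elim: (e i) => [|k IHk]; first exact: mon_span1.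
  apply: (@mon_span_ext _ (fun u w y => cone_point u w y 0 i * cone_point u w y 0 i ^+ k)).
    by move=> u w y; rewrite exprS.
  by rewrite -add1n; apply: mon_span_mul IHk; apply: mon_span_coord.
(* No exponent in the support of [h] reaches the zero branch; it makes the family total, as
   [mon_span_sum] asks. *)
apply: (@mon_span_ext _ (fun u w y => \sum_(e <- [seq e <- msupp h | mdeg e == t])
   h@_e * (if mdeg e == t then ('X_[e] : {mpoly F[n]}).@[cone_point u w y ord0] else 0))).
  move=> u w y; rewrite (_ : [seq _ <- _ | _] = msupp h); last first.
    by apply/all_filterP/allP => e /hh /= ->.
  rewrite [in RHS](mpolyE h) raddf_sum; apply: eq_big_seq => e /hh /= ->.
  by rewrite eqxx mevalZ.
apply: mon_span_sum => e; have [<- //|_] := eqVneq (mdeg e) t.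
by exists (fun=> 0) => u w y; rewrite big1 // => i _; rewrite mul0r.
Qed.

(* Kronecker substitution: at [u j = T ^ D ^ j], [w c = T ^ D ^ (l + c)],
   [y i = T ^ D ^ (l + b + i)] distinct monomials become distinct powers of T. *)
Lemma index_mon_free t (c : word_index l b m t -> F) : (0 < m)%N ->
  (forall u w y, y != 0 -> \sum_i c i * index_mon i u w y = 0) -> forall i, c i = 0.
Proof.
(* A code has at most [2t] letters, so base [2t + 1] rules out carries and the exponents [e i] are
   distinct. *)
move=> m0 c0 i0; pose D := (t.*2).+1.
pose e (i : word_index l b m t) := (\sum_(x <- word_code i) D ^ x)%N.
have e_inj i j : e i = e j -> i = j.
  by move=> eij; apply: word_code_inj; apply: sum_expn_inj eij; rewrite ltnS size_word_code.
pose P : {poly F} := \sum_i c i *: 'X^(e i).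
have P0 : P = 0.
  (* [T] starts at 1 because [T = 0] would make [y] zero. *)
  apply: (@poly_eq0_on_nat _ _ 1) => T T1.
  pose u : 'cV[F]_l := \col_j T%:R ^+ (D ^ j).
  pose w : 'rV[F]_b := \row_j T%:R ^+ (D ^ (l + j)).
  pose y : 'rV[F]_m := \row_j T%:R ^+ (D ^ (l + b + j)).
  have T0 : (T%:R : F) != 0 by rewrite pnatr_eq0 -lt0n.
  have y0 : y != 0.
    apply/eqP => /rowP/(_ (Ordinal m0)) /eqP; rewrite !mxE expf_eq0 (negPf T0).
    by rewrite andbF.
  rewrite -(c0 u w y y0) horner_sum; apply: eq_bigr => i _.
  rewrite hornerZ hornerXn; congr (_ * _).
  rewrite /e /word_code !big_cat /= !big_map !exprD /index_mon /word_mon.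
  rewrite !(big_morph (fun k => T%:R ^+ k : F) (exprD _) (expr0 _)) mulrA.
  by congr (_ * _ * _); apply: eq_bigr => k _; rewrite mxE.
have /polyP/(_ (e i0)) := P0; rewrite coef0 coef_sum (bigD1 i0) //= big1 ?addr0.
  by rewrite coefZ coefXn eqxx mulr1.
by move=> i ii0; rewrite coefZ coefXn; case: (eqVneq (e i0) (e i)) ii0 => [/e_inj->|_ _]; rewrite ?eqxx ?mulr0.
Qed.

Lemma hilbert_function_segre_cone t : (0 < m)%N ->
  hilbert_function segre_cone t #|{: word_index l b m t}|.
Proof.
move=> m0; exists (fun i => index_form (enum_val i)); split.
- by move=> i; apply: index_form_homog.
- move=> c [_ van] i; rewrite -(enum_valK i).
  (* Parameters with [y != 0] give nonzero vectors, hence points of the cone, and suffice for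
     independence. *)
  apply: (@index_mon_free t (fun i => c (enum_rank i))) => // u w y y0.
  have := van (cone_point u w y); rewrite raddf_sum => van0.
  apply: etrans (van0 _); last first.
    split; last by exists u, w, y.
    by apply: contraNneq y0 => v0; rewrite -(p2_point u w y) v0 linear0.
  rewrite [RHS](reindex enum_rank) /=; last first.
      by exists enum_val => j _; rewrite ?enum_rankK ?enum_valK.
  by apply: eq_bigr => j _; rewrite /= mevalZ enum_rankK meval_index_form.
- move=> h hh; have [c hc] := mon_span_homog hh.
  exists (fun i => c (enum_val i)); split.
    rewrite rpredB // rpred_sum // => i _; apply: rpredZ; exact: index_form_homog.
  move=> _ [_ [u [w [y ->]]]].
  rewrite mevalB; apply/eqP; rewrite subr_eq0 hc raddf_sum; apply/eqP.
  rewrite [RHS](reindex enum_rank) /=; last first.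
    by exists enum_val => j _; rewrite ?enum_rankK ?enum_valK.
  by apply: eq_bigr => j _; rewrite mevalZ meval_index_form enum_rankK.
Qed.

(** * Geometry of the cone *)

(** [A] is the Hilbert polynomial of the Segre variety; the convolution adds the [m] vertex
    variables. The leading coefficient is that of [A], namely [1 / ((l-1)! (b-1)!)], times
    [(l+b-2)! / (l+b-2+m)!]. *)
Lemma hilbert_polynomial_segre_cone : (0 < l)%N -> (0 < b)%N -> (0 < m)%N ->
  exists P : {poly rat}, [/\ hilbert_polynomial segre_cone P,
    size P = (l.-1 + b.-1 + m).+1 &
    lead_coef P = 'C(l.-1 + b.-1, l.-1)%:R / (l.-1 + b.-1 + m)`!%:R].
Proof.
move=> l0 b0 m0.
pose A : {poly rat} := bin_poly rat l.-1 * bin_poly rat b.-1.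
have sA : size A = (l.-1 + b.-1).+1.
  by rewrite size_mul -?size_poly_eq0 !size_bin_poly // addSn addnS.
have [P [sP lP eP]] := sum_poly_bin m.-1 sA.
rewrite prednK // in sP lP; exists P; split => //.
  exists 0%N => t _; exists #|{: word_index l b m t}|.
    exact: hilbert_function_segre_cone.
  rewrite eP card_word_index natr_sum; apply: eq_bigr => s _.
  have cS q k : (0 < k)%N -> #|{: sword q k}| = 'C(q + k.-1, k.-1) by case: k => // k _; exact: card_sword.
  by rewrite !cS // hornerM !bin_polyE !natrM.
rewrite lP lead_coefM !lead_bin_poly; congr (_ / _).
have e := bin_fact (leq_addr b.-1 l.-1).
rewrite addKn in e; rewrite -e natrM natrM.
have nz k : (k`!%:R : rat) != 0 by rewrite pnatr_eq0 -lt0n fact_gt0.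
by field; rewrite !nz.
Qed.

(** These forms together cut out the sum of the images of [f] and [g]. *)
Definition lform (k : 'I_n) : {mpoly F[n]} :=
  lin_mpoly (fun x => (x - (f (p1 x) + g (p2 x))) 0 k).
Definition minor i j k c : {mpoly F[n]} := mform i j * mform k c - mform i c * mform k j.

Lemma lform_scalar k : scalar (fun x => (x - (f (p1 x) + g (p2 x))) 0 k).
Proof. by move=> a x x'; rewrite !linearP /= !mxE; ring. Qed.

Lemma van_lform k : van_forms segre_cone 1 (lform k).
Proof.
split=> [|_ [_ [u [w [y ->]]]]]; first exact: lin_mpoly_homog.
by rewrite meval_lin_mpoly ?p1_point ?p2_point ?subrr ?mxE //; exact: lform_scalar.
Qed.

Lemma van_minor i j k c : van_forms segre_cone 2 (minor i j k c).
Proof.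
split=> [|_ [_ [u [w [y ->]]]]].
  by rewrite rpredB // -[2%N]/(1 + 1)%N; apply: dhomogM; apply: lin_mpoly_homog.
rewrite mevalB !mevalM !meval_mform p1_point !mxE !big_ord1; ring.
Qed.

Lemma outer_product (M : 'M[F]_(l, b)) :
  (forall i j k c, M i j * M k c = M i c * M k j) ->
  exists (u : 'cV_l) (w : 'rV_b), M = u *m w.
Proof.
move=> minM; have [->|/matrix0Pn[i [j Mij]]] := eqVneq M 0.
  by exists 0, 0; rewrite mul0mx.
(* A nonzero entry is the pivot: [M] is its column times its row, divided by the pivot. *)
exists (col j M), ((M i j)^-1 *: row i M); apply/matrixP => k c.
by rewrite mxE big_ord1 !mxE mulrCA -minM; field.
Qed.

(** Forms vanishing on the cone vanish on [X], hence on its closure; the linear forms and the minors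
    already force the shape [cone_point]. *)
Lemma zariski_closure_sub (X : set 'rV[F]_n) :
  X `<=` segre_cone -> zariski_closure X `<=` segre_cone.
Proof.
move=> XY x [x0 clx]; split=> //.
have van_sub t h : van_forms segre_cone t h -> h.@[x ord0] = 0.
  by move=> [hh vh]; apply: (clx t); split=> // z /XY; apply: vh.
have [|u [w e]] := @outer_product (p1 x).
  move=> i j k c; apply/eqP; rewrite -subr_eq0.
  have := van_sub _ _ (van_minor i j k c).
  by rewrite mevalB !mevalM !meval_mform => ->.
exists u, w, (p2 x); rewrite /cone_point -e; apply/eqP; rewrite -subr_eq0.
apply/eqP/rowP => k; have := van_sub _ _ (van_lform k).
by rewrite meval_lin_mpoly => [->|]; [rewrite mxE | exact: lform_scalar].
Qed.

Lemma tangent_space_lin X x a (v v' : 'rV[F]_n) :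
  tangent_space X x v -> tangent_space X x v' -> tangent_space X x (a *: v + v').
Proof.
move=> Tv Tv' t h vh; rewrite (eq_bigr (fun i => a * (v ord0 i * (h^`M(i)).@[x ord0]) +
    v' ord0 i * (h^`M(i)).@[x ord0])); last first.
  by move=> i _; rewrite !mxE mulrDl mulrA.
by rewrite big_split -mulr_sumr /= (Tv t) // (Tv' t) // mulr0 addr0.
Qed.

Lemma tangent_space_decomp x v :
  tangent_space segre_cone x v -> v = f (p1 v) + g (p2 v).
Proof.
move=> Tv; apply/eqP; rewrite -subr_eq0; apply/eqP/rowP => k.
have := Tv _ _ (van_lform k); rewrite -/(dir_deriv _ _ _) dir_deriv_lin_mpoly => [->|].
  by rewrite mxE.
exact: lform_scalar.
Qed.

Lemma tangent_line (X : set 'rV[F]_n) (x v : 'rV[F]_n) : x != 0 ->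
  (forall s, x + s *: v != 0 -> X (x + s *: v)) -> tangent_space X x v.
Proof.
move=> x0 Xl t h [_ vh].
have [q hq] := meval_taylor (v ord0) (x ord0) h.
have hx : h.@[x ord0] = 0.
  by apply: vh; have := Xl 0; rewrite scale0r addr0; apply.
rewrite -/(dir_deriv _ _ _); set D := dir_deriv _ _ _ in hq *.
suff P0 : D *: 'X + 'X^2 * q = 0 :> {poly F}.
  by have /polyP/(_ 1%N) := P0; rewrite coefD coefZ coefX mulr1 coefXnM coef0 addr0.
have hs s : x + s *: v != 0 -> (D *: 'X + 'X^2 * q).[s] = 0.
  move=> /Xl /vh e; rewrite !hornerE; rewrite -[RHS]e -[LHS]add0r -hx mulrC.
  rewrite addrA -hq; apply: meval_eq => k; by rewrite !mxE.
(* As [x != 0], at most one parameter value gives the zero vector, which represents no point; the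
   integers beyond it are all usable. *)
have [N hN] : exists N : nat, forall k : nat, (N <= k)%N -> x + k%:R *: v != 0.
  have [[k /eqP hk]|nk] := boolp.pselect (exists k : nat, x + k%:R *: v == 0).
    exists k.+1 => k' kk'; apply: contraNneq x0 => hk'.
    have : (k'%:R - k%:R) *: v = 0.
      by rewrite scalerBl -[LHS]addr0 -[0 in LHS](subrr x) addrACA -opprD (addrC _ x) (addrC _ x) hk hk' subrr.
    move/eqP; rewrite scaler_eq0 subr_eq0 eqr_nat gtn_eqF //= => /eqP v0.
    by rewrite -hk v0 scaler0 addr0.
  by exists 0%N => k _; apply/negP => hk; apply: nk; exists k.
by apply: (@poly_eq0_on_nat _ _ N) => k /hN; apply: hs.
Qed.

Definition vertex : {vspace 'rV[F]_n} := limg (linfun g).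
Definition segre_span : {vspace 'rV[F]_n} := limg (linfun f).

Lemma vertexP v : reflect (exists y, v = g y) (v \in vertex).
Proof.
apply: (iffP idP) => [/memv_imgP[y _ ->]|[y ->]]; first by exists y; rewrite lfunE.
by rewrite -(lfunE g); apply/memv_img/memvf.
Qed.

Lemma segre_spanP v : reflect (exists M, v = f M) (v \in segre_span).
Proof.
apply: (iffP idP) => [/memv_imgP[y _ ->]|[y ->]]; first by exists y; rewrite lfunE.
by rewrite -(lfunE f); apply/memv_img/memvf.
Qed.

Lemma dim_vertex : \dim vertex = m.
Proof.
rewrite /vertex limg_dim_eq; first by rewrite dimvf dim_matrix mul1r.
by rewrite capfv; apply/eqP/lker0P => y y'; rewrite !lfunE; apply: can_inj p2g _ _.
Qed.

Lemma dim_segre_span : \dim segre_span = (l * b)%N.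
Proof.
rewrite /segre_span limg_dim_eq ?dimvf ?dim_matrix //.
by rewrite capfv; apply/eqP/lker0P => y y'; rewrite !lfunE; apply: can_inj p1f _ _.
Qed.

Lemma segre_vertex_disjoint v : v \in segre_span -> v \in vertex -> v = 0.
Proof.
move=> /segre_spanP[M ->] /vertexP[y e].
by rewrite -(p1f M) e p1g linear0.
Qed.

(** The linear forms give the upper bound. Conversely, lines through [g y] in the direction of the
    image of a matrix unit, or of a vertex vector, stay in the cone, and these directions span. *)
Lemma tangent_space_vertex y : y != 0 ->
  has_vdim (tangent_space segre_cone (g y)) (l * b + m).
Proof.
move=> y0.
exists (segre_span + vertex)%VS; last first.
  rewrite dimv_disjoint_sum ?dim_segre_span ?dim_vertex //.
  apply/eqP; rewrite -subv0; apply/subvP => v; rewrite memv_cap memv0.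
  by move=> /andP[v1 v2]; apply/eqP; apply: segre_vertex_disjoint.
have gy0 : g y != 0 by apply: contraNneq y0 => e; rewrite -(p2g y) e linear0.
apply/seteqP; split=> v.
  move=> /tangent_space_decomp -> /=.
  by apply: memv_add; [apply/segre_spanP; exists (p1 v) | apply/vertexP; exists (p2 v)].
have T0 : tangent_space segre_cone (g y) 0.
  by move=> t h _; rewrite big1 // => i _; rewrite mxE mul0r.
move=> /memv_addP[_ /segre_spanP[M ->] [_ /vertexP[y' ->] ->]].
rewrite -[f M]scale1r; apply: tangent_space_lin.
  rewrite [M]matrix_sum_delta linear_sum.
  apply: (big_ind (tangent_space segre_cone (g y))) => // [v1 v2 T1 T2|i _].
    by rewrite -[v1]scale1r; apply: tangent_space_lin.
  rewrite linear_sum.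
  apply: (big_ind (tangent_space segre_cone (g y))) => // [v1 v2 T1 T2|j _].
    by rewrite -[v1]scale1r; apply: tangent_space_lin.
  rewrite linearZ /= -[_ *: _]addr0; apply: tangent_space_lin => //.
  apply: tangent_line => // s ps; split=> //.
  exists (s *: delta_mx i 0), (delta_mx 0 j), y.
  by rewrite /cone_point -scalemxAl mul_delta_mx linearZ addrC.
apply: tangent_line => // s ps; split=> //.
by exists 0, 0, (y + s *: y'); rewrite /cone_point mul0mx linear0 add0r linearD linearZ.
Qed.

(* With [A = p1 x] and [A i j != 0], the differential of the minor
   [A i j * M q c - A i c * M q j] shows that the matrix part of a tangent vector
   is determined by its i-th row and j-th column. *)
Lemma tangent_space_nonvertex x k : p1 x != 0 ->
  has_vdim (tangent_space segre_cone x) k -> (k <= l.-1 + b + m)%N.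
Proof.
move=> /matrix0Pn[i [j xij]] [U TU <-].
(* [rho] keeps row [i], column [j] without the entry they share, and the vertex part: [b + l.-1 + m]
   scalars. The bound follows from injectivity of [rho] on [U]. *)
pose rho (v : 'rV[F]_n) := (row i (p1 v), (row' i (col j (p1 v)), p2 v)).
have rho_lin : linear rho by move=> a v v'; rewrite /rho !linearP.
pose rhoL : {linear _ -> _} := HB.pack rho (GRing.isLinear.Build _ _ _ _ rho rho_lin).
have : (\dim (linfun rhoL @: U) <= \dim {: ('rV[F]_b * ('cV[F]_l.-1 * 'rV[F]_m))%type})%N.
  by apply: dimvS; apply: subvf.
rewrite limg_dim_eq.
  rewrite dimvf => /leq_trans; apply.
  rewrite -[X in (X <= _)%N]/(1 * b + (l.-1 * 1 + 1 * m))%N.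
  by rewrite mul1n muln1 mul1n addnA (addnC b).
apply/eqP; rewrite -subv0; apply/subvP => v; rewrite memv_cap memv_ker lfunE memv0 /=.
move=> /andP[vU /eqP[r0 [c0 y0]]].
have Tv : tangent_space segre_cone x v by rewrite TU.
rewrite (tangent_space_decomp Tv) y0 linear0 addr0.
suff -> : p1 v = 0 by rewrite linear0.
have ri c : p1 v i c = 0 by have /rowP/(_ c) := r0; rewrite !mxE.
have cj q : p1 v q j = 0.
  case: (unliftP i q) => [q' ->|->] //.
  by have /colP/(_ q') := c0; rewrite !mxE.
apply/matrixP => q c; rewrite [RHS]mxE; apply: (mulfI xij); rewrite mulr0.
have := Tv _ _ (van_minor i j q c); rewrite -/(dir_deriv _ _ _).
rewrite dir_derivD dir_derivN !dir_derivM.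
rewrite !dir_deriv_lin_mpoly ?ri ?cj ?meval_mform; try exact: p1_scalar.
by rewrite !mul0r !mulr0 !add0r subr0.
Qed.

Lemma is_cone_segre_cone : is_cone (f @` segre F l b) vertex segre_cone.
Proof.
split=> [v spanv|].
  apply: segre_vertex_disjoint; apply: spanv => _ [M _ <-].
  by apply/segre_spanP; exists M.
apply/seteqP; split=> v [v0].
  move=> [u [w [y e]]]; split=> //; exists (f (u *m w)), (g y).
  split=> //; last by apply/vertexP; exists y.
  have [->|uw0] := eqVneq (u *m w) 0; [by right; rewrite linear0 | left].
  exists (u *m w) => //; apply/eqP; rewrite eqn_leq mulmx_max_rank lt0n.
  by rewrite mxrank_eq0.
move=> [x [_ [Xx /vertexP[y ->] e]]]; split=> //.
case: Xx e => [[M rM <-]|->] ->; last first.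
  by exists 0, 0, y; rewrite /cone_point mul0mx linear0.
suff [u [w ->]] : exists (u : 'cV_l) (w : 'rV_b), M = u *m w by exists u, w, y.
(* For rank 1 these bases are a column and a row with product [M]. *)
move: (col_base M) (row_base M) (mulmx_base M).
by rewrite rM => u w <-; exists u, w.
Qed.

Lemma proj_dim_segre_cone d : (0 < l)%N -> (0 < b)%N -> (0 < m)%N ->
  proj_dim segre_cone d <-> d = (l.-1 + b.-1 + m)%N.
Proof.
move=> l0 b0 m0; have [P [hP sP _]] := hilbert_polynomial_segre_cone l0 b0 m0.
split=> [[P' hP' sP']|->]; last by exists P.
by move: sP'; rewrite -(hilbert_polynomial_uniq hP hP') sP => -[].
Qed.

(** Off the vertex the tangent space has dimension at most [l + b - 1 + m], that of the affine cone.
    On the vertex it has dimension [l * b + m], which is larger since [l - 1] and [b - 1] are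
    positive. *)
Lemma singular_locus_segre_cone : (1 < l)%N -> (1 < b)%N -> (0 < m)%N ->
  singular_locus segre_cone = proj_linear vertex.
Proof.
move=> l1 b1 m0.
have pd d := proj_dim_segre_cone d (ltnW l1) (ltnW b1) m0.
apply/seteqP; split=> x.
  move=> [[x0 [u [w [y e]]]] [d [k [/pd -> Tk dk]]]].
  have [uw0|uw0] := eqVneq (u *m w) 0.
    by split=> //; apply/vertexP; exists y; rewrite e /cone_point uw0 linear0 add0r.
  have := tangent_space_nonvertex _ Tk; rewrite e p1_point => /(_ uw0) kle.
  by exfalso; move: dk kle; lia.
move=> [x0 /vertexP[y e]]; split.
  by split=> //; exists 0, 0, y; rewrite /cone_point mul0mx linear0 add0r.
exists (l.-1 + b.-1 + m)%N, (l * b + m)%N; split; first exact/pd.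
  rewrite e; apply: tangent_space_vertex.
  by apply: contraNneq x0 => y0; rewrite e y0 linear0.
by case: (l) (b) l1 b1 => [|[|l1]] [|[|b1]] //= _ _; nia.
Qed.

Lemma proj_degree_segre_cone : (0 < l)%N -> (0 < b)%N -> (0 < m)%N ->
  proj_degree segre_cone 'C(l.-1 + b.-1, l.-1).
Proof.
move=> l0 b0 m0; have [P [hP sP lP]] := hilbert_polynomial_segre_cone l0 b0 m0.
by exists P, (l.-1 + b.-1 + m)%N.
Qed.

(** The matrix space is zero and the cone is one point: only [s = 0] contributes to the Hilbert
    function, which is constantly 1. *)
Lemma proj_degree_segre_cone_point : b = 0%N -> m = 1%N -> proj_degree segre_cone 1.
Proof.
move=> b0 m1; exists 1, 0%N; rewrite size_poly1 lead_coef1 fact0 divr1; split=> //.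
exists 0%N => t _; exists #|{: word_index l b m t}|.
  by apply: hilbert_function_segre_cone; rewrite m1.
rewrite hornerC card_word_index b0 m1 big_ord_recl big1 => [|i _].
  by rewrite card_sword_nil card_sword0 card_sword bin0.
by rewrite card_sword0 muln0.
Qed.

(** A line in the parameters gives a curve with coordinates quadratic in [t], along which vanishing
    at large integers spreads to all of [F]. *)
Lemma cone_point_curve (h : {mpoly F[n]}) u1 u2 w1 w2 y1 y2 :
  exists p : {poly F}, forall t : F,
    p.[t] = h.@[cone_point (u1 + t *: u2) (w1 + t *: w2) (y1 + t *: y2) 0].
Proof.
pose a := f (u1 *m w1) + g y1; pose a1 := f (u1 *m w2) + f (u2 *m w1) + g y2.
pose a2 := f (u2 *m w2).
have [p hp] := meval_curve (fun k => (a 0 k)%:P + a1 0 k *: 'X + a2 0 k *: 'X^2) h.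
exists p => t; rewrite hp; apply: meval_eq => k.
rewrite !hornerE /cone_point mulmxDl !mulmxDr -!scalemxAl -!scalemxAr scalerA.
by rewrite !linearD !linearZ /= /a /a1 /a2 !mxE; ring.
Qed.

End ConeOverSegre.

(** * The model *)

Section Coordinates.
Variables (l m : nat) (m_gt0 : (0 < m)%N).
Variable K : comNzRingType.
Implicit Types (w : 'rV[K]_(m.-1 * m.-1)) (y : 'rV[K]_m) (i : mtd_index l m).

Lemma pred_ltn_m : (m.-1 < m)%N. Proof. by rewrite prednK. Qed.

Definition omax : 'I_m := Ordinal pred_ltn_m.
Definition owid (p : 'I_m.-1) : 'I_m := widen_ord (leq_pred m) p.

Lemma omaxP (a : 'I_m) : a = omax \/ exists p, a = owid p.
Proof.
have [am|am] := ltnP a m.-1; [right | left]; last first.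
  by apply: val_inj; apply/eqP; rewrite eqn_leq am andbT -ltnS prednK /=.
by exists (Ordinal am); apply: val_inj.
Qed.

Lemma sum_omax (h : 'I_m -> K) : \sum_k h k = \sum_(r < m.-1) h (owid r) + h omax.
Proof.
rewrite /omax /owid; move: pred_ltn_m (leq_pred m) h.
case: (m) m_gt0 => // m' _ /= p1 p2 h; rewrite big_ord_recr /=; congr (_ + _).
  by apply: eq_bigr => r _; congr h; apply: val_inj.
by congr h; apply: val_inj.
Qed.

(* The m x m matrix with zero last row and zero row sums whose upper left block
   is w. *)
Definition rext w (a k : 'I_m) : K :=
  \sum_(p < m.-1) \sum_(q < m.-1)
    (p == a :> nat)%:R * w 0 (mxvec_index p q) * ((q == k :> nat)%:R - (k == m.-1 :> nat)%:R).

Lemma rext_is_linear a k : scalar (fun w => rext w a k).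
Proof.
move=> c w w'; rewrite mulr_sumr -big_split; apply: eq_bigr => p _ /=.
rewrite mulr_sumr -big_split; apply: eq_bigr => q _ /=.
by rewrite !mxE; ring.
Qed.

Lemma rextZ c w a k : rext (c *: w) a k = c * rext w a k.
Proof.
have := rext_is_linear a k c w 0; rewrite addr0 => ->.
have := rext_is_linear a k 0 0 0; rewrite scale0r addr0 mul0r add0r => e.
rewrite -[RHS]addr0; congr (_ + _).
by rewrite /rext big1 // => p _; rewrite big1 // => q _; rewrite mxE mulr0 mul0r.
Qed.

Lemma rext_max w k : rext w omax k = 0.
Proof.
rewrite /rext big1 // => p _; rewrite big1 // => q _.
by rewrite ltn_eqF ?mul0r //=.
Qed.

Lemma rext_sum w a : \sum_k rext w a k = 0.
Proof.
rewrite exchange_big big1 //= => p _; rewrite exchange_big big1 //= => q _.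
rewrite -mulr_sumr sumrB (bigD1 (owid q)) //= eqxx big1 => [|k kq].
  rewrite (bigD1 omax) //= eqxx big1 => [|k km]; first by rewrite !addr0 subrr mulr0.
  by rewrite -[X in (X == _)%:R]/(val k) -[m.-1]/(val omax) (inj_eq val_inj) (negPf km).
by rewrite -[X in (X == _)%:R]/(val (owid q)) (inj_eq val_inj) eq_sym (negPf kq).
Qed.

Lemma rext_widl w p k :
  rext w (owid p) k =
  \sum_(q < m.-1) w 0 (mxvec_index p q) * ((q == k :> nat)%:R - (k == m.-1 :> nat)%:R).
Proof.
rewrite /rext (bigD1 p) //= [X in _ + X]big1 ?addr0 => [|p' pp'].
  by apply: eq_bigr => q _; rewrite eqxx mul1r.
by rewrite big1 // => q _; rewrite -val_eqE /= in pp'; rewrite (negPf pp') !mul0r.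
Qed.

Lemma rext_wid w p q : rext w (owid p) (owid q) = w 0 (mxvec_index p q).
Proof.
rewrite rext_widl (bigD1 q) //= big1 ?addr0 => [|q' qq'].
  by rewrite eqxx ltn_eqF // subr0 mulr1.
rewrite -val_eqE /= in qq'.
by rewrite (negPf qq') (ltn_eqF (ltn_ord q)) subrr mulr0.
Qed.

Lemma rext_widmax w p : rext w (owid p) omax = - \sum_q w 0 (mxvec_index p q).
Proof.
rewrite rext_widl -sumrN; apply: eq_bigr => q _ /=.
by rewrite eqxx ltn_eqF //= sub0r mulrN1.
Qed.

(** Subtracting the last row leaves zero row sums and a zero last row, so the upper left block
    determines the difference. *)
Lemma rext_of_rows (q : 'I_m -> 'I_m -> K) :
  (forall a, \sum_k q a k = \sum_k q omax k) -> forall a k,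
  rext (mxvec (\matrix_(p, r) (q (owid p) (owid r) - q omax (owid r)))) a k =
  q a k - q omax k.
Proof.
move=> hq a k.
have [->|[p ->]] := omaxP a; first by rewrite rext_max subrr.
have [->|[r ->]] := omaxP k; last by rewrite rext_wid mxvecE mxE.
rewrite rext_widmax; under eq_bigr do rewrite mxvecE mxE.
rewrite sumrB; have := hq (owid p); rewrite !sum_omax.
set A := \sum_(_ < _) _; set B := \sum_(_ < _) _ => e.
by rewrite opprB; apply/eqP; rewrite subr_eq addrAC eq_sym subr_eq addrC e.
Qed.

(** Coordinates that isolate the parameters: with [omax] in all positions before the last only [y]
    is seen, and changing position [j] alone to [owid p] adds one matrix entry from row [j]. *)
Definition base_idx (k : 'I_m) : mtd_index l m :=
  [tuple if i == l :> nat then k else omax | i < l.+1].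
Definition cell_idx (j : 'I_l) (p q : 'I_m.-1) : mtd_index l m :=
  [tuple if i == l :> nat then owid q else if i == j :> nat then owid p else omax | i < l.+1].

Lemma base_idx_last k : tnth (base_idx k) ord_max = k.
Proof. by rewrite tnth_mktuple eqxx. Qed.
Lemma base_idx_wid k (j : 'I_l) : tnth (base_idx k) (widen_ord (leqnSn l) j) = omax.
Proof. by rewrite tnth_mktuple ltn_eqF /=. Qed.
Lemma cell_idx_last j p q : tnth (cell_idx j p q) ord_max = owid q.
Proof. by rewrite tnth_mktuple eqxx. Qed.
Lemma cell_idx_wid j p q (j' : 'I_l) :
  tnth (cell_idx j p q) (widen_ord (leqnSn l) j') = if j' == j then owid p else omax.
Proof. by rewrite tnth_mktuple ltn_eqF /=. Qed.

(** Row [j] of [M] lists the free entries of the matrix of row differences used at position [j]; for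
    [u *m w] it is [u j 0] times a common matrix. *)
Definition emb_mx (M : 'M[K]_(l, m.-1 * m.-1)) : 'rV[K]_(mtd_ncoord l m) :=
  \row_k let i : mtd_index l m := enum_val k in
    \sum_(j < l) rext (row j M) (tnth i (widen_ord (leqnSn l) j)) (tnth i ord_max).
Definition emb_row y : 'rV[K]_(mtd_ncoord l m) :=
  \row_k let i : mtd_index l m := enum_val k in y 0 (tnth i ord_max).
Definition ret_row (x : 'rV[K]_(mtd_ncoord l m)) : 'rV[K]_m :=
  \row_k x 0 (enum_rank (base_idx k)).
(** Subtracting the base coordinate removes the contribution of [y]. *)
Definition ret_mx (x : 'rV[K]_(mtd_ncoord l m)) : 'M[K]_(l, m.-1 * m.-1) :=
  \matrix_(j < l) mxvec (\matrix_(p, q)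
    (x 0 (enum_rank (cell_idx j p q)) - x 0 (enum_rank (base_idx (owid q))))).

Lemma emb_mx_is_linear : linear emb_mx.
Proof.
move=> c M M'; apply/rowP => k; rewrite !mxE mulr_sumr -big_split.
by apply: eq_bigr => j _; rewrite linearP /= rext_is_linear.
Qed.
HB.instance Definition _ := GRing.isLinear.Build _ _ _ _ emb_mx emb_mx_is_linear.

Lemma emb_row_is_linear : linear emb_row.
Proof. move=> c y y'; apply/rowP => k; by rewrite !mxE /= !mxE. Qed.
HB.instance Definition _ := GRing.isLinear.Build _ _ _ _ emb_row emb_row_is_linear.

Lemma ret_row_is_linear : linear ret_row.
Proof. by move=> c y y'; apply/rowP => k; rewrite !mxE. Qed.
HB.instance Definition _ := GRing.isLinear.Build _ _ _ _ ret_row ret_row_is_linear.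

Lemma ret_mx_is_linear : linear ret_mx.
Proof.
move=> c x x'; apply/row_matrixP => j; rewrite linearP /= !rowK -linearP /=.
by congr mxvec; apply/matrixP => p q; rewrite !mxE; ring.
Qed.
HB.instance Definition _ := GRing.isLinear.Build _ _ _ _ ret_mx ret_mx_is_linear.

Lemma emb_mxK : cancel emb_mx ret_mx.
Proof.
move=> M; apply/row_matrixP => j; rewrite rowK.
apply: (canLR vec_mxK); apply/matrixP => p q; rewrite !mxE !enum_rankK.
rewrite /= cell_idx_last base_idx_last.
rewrite [X in _ - X]big1 => [|j' _]; last by rewrite base_idx_wid rext_max.
rewrite subr0 (bigD1 j) //= big1 => [|j' jj'].
  by rewrite cell_idx_wid eqxx addr0 rext_wid mxE.
by rewrite cell_idx_wid (negPf jj') rext_max.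
Qed.

Lemma ret_row_emb_mx M : ret_row (emb_mx M) = 0.
Proof.
apply/rowP => k; rewrite !mxE enum_rankK /= big1 // => j _.
by rewrite base_idx_wid rext_max.
Qed.

Lemma ret_mx_emb_row y : ret_mx (emb_row y) = 0.
Proof.
apply/row_matrixP => j; rewrite rowK row0 -[RHS](linear0 mxvec); congr mxvec.
apply/matrixP => p q; rewrite !mxE !enum_rankK.
by rewrite /= cell_idx_last base_idx_last subrr.
Qed.

Lemma emb_rowK : cancel emb_row ret_row.
Proof. by move=> y; apply/rowP => k; rewrite !mxE enum_rankK /= base_idx_last. Qed.

Lemma emb_pointE (u : 'cV[K]_l) w y (k : 'I_(mtd_ncoord l m)) :
  (emb_mx (u *m w) + emb_row y) 0 k =
  let i : mtd_index l m := enum_val k in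
  \sum_(j < l) u j 0 * rext w (tnth i (widen_ord (leqnSn l) j)) (tnth i ord_max)
  + y 0 (tnth i ord_max).
Proof.
rewrite !mxE /=; congr (_ + _); apply: eq_bigr => j _.
rewrite -rextZ; congr rext; apply/rowP => c; by rewrite !mxE big_ord1.
Qed.

End Coordinates.

Lemma rext_map (R : realType) m (m_gt0 : (0 < m)%N) (w : 'rV[R]_(m.-1 * m.-1)) a k :
  rext (map_mx (real_complex R) w) a k = real_complex R (rext w a k).
Proof.
rewrite /rext rmorph_sum; apply: eq_bigr => p _.
rewrite rmorph_sum; apply: eq_bigr => q _.
by rewrite !rmorphM rmorphB !rmorph_nat mxE.
Qed.

(** * The closure of the model is the cone *)

Section MTDCone.
Variables (R : realType) (l m : nat) (l_gt0 : (0 < l)%N) (m_gt0 : (0 < m)%N).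
Let F : numFieldType := R[i].
Let b := (m.-1 * m.-1)%N.
Let f : {linear 'M[F]_(l, b) -> 'rV[F]_(mtd_ncoord l m)} := @emb_mx l m F.
Let g : {linear 'rV[F]_m -> 'rV[F]_(mtd_ncoord l m)} := @emb_row l m F.
Let p1 : {linear 'rV[F]_(mtd_ncoord l m) -> 'M[F]_(l, b)} := @ret_mx l m m_gt0 F.
Let p2 : {linear 'rV[F]_(mtd_ncoord l m) -> 'rV[F]_m} := @ret_row l m m_gt0 F.
Local Notation rc := (real_complex R).
Implicit Types (u : 'cV[R]_l) (w : 'rV[R]_b) (y : 'rV[R]_m).

Definition real_point u w y : 'rV[R]_(mtd_ncoord l m) := emb_mx (u *m w) + emb_row l y.

Lemma map_real_point u w y : map_mx rc (real_point u w y) =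
  cone_point f g (map_mx rc u) (map_mx rc w) (map_mx rc y).
Proof.
apply/rowP => k; rewrite mxE /real_point /cone_point !emb_pointE /= rmorphD rmorph_sum.
congr (_ + _); last by rewrite mxE.
by apply: eq_bigr => j _; rewrite rmorphM /= rext_map // mxE.
Qed.

Lemma cone_pointZ c (u : 'cV[F]_l) (w : 'rV[F]_b) (y : 'rV[F]_m) :
  c *: cone_point f g u w y = cone_point f g (c *: u) w (c *: y).
Proof. by rewrite /cone_point scalerDr -scalemxAl !linearZ. Qed.

Let ml_neq0 : ((m ^ l)%:R : R) != 0.
Proof. by rewrite pnatr_eq0 -lt0n expn_gt0 m_gt0. Qed.

Lemma mtd_map_real_point (q : 'M[R]_m) (lam : 'rV[R]_l) :
  transition_matrices q -> @simplex R l lam ->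
  mtd_map q lam = real_point lam^T
    ((m ^ l)%:R^-1 *: mxvec (\matrix_(p, r) (q (owid p) (owid r) - q (omax m_gt0) (owid r))))
    ((m ^ l)%:R^-1 *: row (omax m_gt0) q).
Proof.
move=> hq [_ sl]; apply/rowP => k; rewrite /real_point emb_pointE // mxE /= !mxE.
(* The weights sum to 1, which distributes the last row of [q] over the summands of the mixture. *)
set i := enum_val k; rewrite -[X in _ = _ + _ * X]mul1r -sl.
rewrite mulr_suml mulr_sumr mulr_sumr -big_split; apply: eq_bigr => j _ /=.
rewrite rextZ (rext_of_rows (m_gt0 := m_gt0)); first by rewrite mxE; ring.
have rows a : \sum_k q a k = 1.
  by have [_ <-] := hq a; apply: eq_bigr => k' _; rewrite mxE.
by move=> a; rewrite !rows.
Qed.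

Lemma MTD_proj_sub : MTD_proj R l m `<=` segre_cone f g.
Proof.
move=> x [_ [q hq [lam hlam <-]] [c c0 ->]].
rewrite mtd_map_real_point // map_real_point cone_pointZ.
set u := c *: _; set w := map_mx rc _; set y := c *: _.
split; last by exists u, w, y.
(* The last row of [q] sums to 1, so the entries of [y] sum to [c / m ^ l]. *)
have y0 : y != 0.
  apply/eqP => y0; have : \sum_k y 0 k = 0 by rewrite y0 big1 // => k _; rewrite mxE.
  under eq_bigr do rewrite !mxE; rewrite -mulr_sumr -rmorph_sum -mulr_sumr /=.
  have [_ s1] := hq (omax m_gt0).
  rewrite (eq_bigr (fun k => (row (omax m_gt0) q) ord0 k)); last by move=> k _; rewrite mxE.
  rewrite s1 mulr1 => /eqP; rewrite mulf_eq0 (negPf c0) /= fmorph_eq0 invr_eq0.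
  by rewrite (negPf ml_neq0).
apply: contraNneq y0 => x0.
have <- : p2 (cone_point f g u w y) = y.
  by apply: (p2_point (p2 := p2)); [exact: ret_row_emb_mx | exact: emb_rowK].
by rewrite x0 linear0.
Qed.

(** Dividing by [sig] and [s] normalizes the parameters; the rows of [q] then sum to 1 because
    [rext] has zero row sums. The scalar [s * m ^ l] undoes the normalization. *)
Lemma real_point_MTD u w y : (forall j, 0 <= u j 0) -> 0 < \sum_j u j 0 ->
  0 < \sum_k y 0 k -> (forall a k, 0 <= y 0 k + (\sum_j u j 0) * rext w a k) ->
  MTD_proj R l m (cone_point f g (map_mx rc u) (map_mx rc w) (map_mx rc y)).
Proof.
set sig := \sum_j _; set s := \sum_k _ => u0 sig0 s0 q0.
have sN : s != 0 by rewrite gt_eqF.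
have sigN : sig != 0 by rewrite gt_eqF.
pose q := \matrix_(a, k) ((y 0 k + sig * rext w a k) / s).
pose lam := \row_j (u j 0 / sig).
exists (mtd_map q lam).
  exists q; last first.
    exists lam => //; split=> [j|]; first by rewrite mxE divr_ge0 // ltW.
    by under eq_bigr do rewrite mxE; rewrite -mulr_suml divff.
  move=> a; split=> [k|]; first by rewrite !mxE divr_ge0 // ltW.
  under eq_bigr do rewrite !mxE.
  by rewrite -mulr_suml big_split -mulr_sumr /= rext_sum // mulr0 addr0 divff.
exists (rc (s * (m ^ l)%:R)); first by rewrite fmorph_eq0 mulf_neq0.
rewrite -map_real_point -map_mxZ; congr map_mx; apply/rowP => k.
rewrite /real_point emb_pointE /= !mxE; set i := enum_val k.
rewrite mulrA mulfK // mulr_sumr.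
rewrite [RHS](eq_bigr (fun j => u j 0 * rext w (tnth i (widen_ord (leqnSn l) j)) (tnth i ord_max)
   + u j 0 / sig * y 0 (tnth i ord_max))); last first.
  by move=> j _; rewrite !mxE; field; rewrite sN sigN.
by rewrite big_split -!mulr_suml divff // mul1r.
Qed.

Section Vanishing.
Variables (t : nat) (h : {mpoly F[mtd_ncoord l m]}).
Hypothesis van_h : van_forms (MTD_proj R l m) t h.

(* For K large, [K + u], [w] and [C K + y] are proportional to the parameters of
   a point of MTD; the value of h there is a polynomial in K, so it also vanishes
   at K = 0. *)
Lemma van_real u w y :
  h.@[cone_point f g (map_mx rc u) (map_mx rc w) (map_mx rc y) 0] = 0.
Proof.
(* [K * C] contains [l * K] times a bound on all entries of [rext w], which offsets the growing
   weights, and a spare [K] for the terms that do not grow. *)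
pose C := 1 + l%:R * \sum_a \sum_k `|rext w a k|.
have rC a k : `|rext w a k| <= \sum_a \sum_k `|rext w a k|.
  rewrite (bigD1 a) //= (bigD1 k) //= -addrA lerDl addr_ge0 ?sumr_ge0 // => a' _.
  exact: sumr_ge0.
set r := \sum_a _ in C rC; have r0 : 0 <= r by apply: sumr_ge0 => a _; apply: sumr_ge0.
(* [B] bounds the terms independent of [K]; for [K >= B] the conditions of [real_point_MTD] hold. *)
pose B := 1 + \sum_j `|u j 0| + \sum_k `|y 0 k| + (\sum_j `|u j 0|) * r.
have uB j : `|u j 0| <= \sum_j `|u j 0| by rewrite (bigD1 j) //= lerDl sumr_ge0.
have yB k : `|y 0 k| <= \sum_k `|y 0 k| by rewrite (bigD1 k) //= lerDl sumr_ge0.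
set su := \sum_j _ in uB B; set sy := \sum_k _ in yB B.
have su0 : 0 <= su by apply: sumr_ge0.
have sy0 : 0 <= sy by apply: sumr_ge0.
have [p hp] := cone_point_curve f g h (map_mx rc u) (const_mx 1) (map_mx rc w) 0
  (map_mx rc y) (const_mx (rc C)).
suff p0 : p = 0.
  by have := hp 0; rewrite p0 horner0 !scale0r !addr0.
apply: (@poly_eq0_on_nat _ _ (Num.bound B)) => K BK.
have {}BK : B <= K%:R.
  by apply: le_trans (ltW (archi_boundP _)) _; rewrite ?ler_nat // !addr_ge0 // mulr_ge0.
rewrite hp scaler0 addr0.
have mapE k1 k2 (M : 'M[R]_(k1, k2)) c :
    map_mx rc M + K%:R *: const_mx (rc c) = map_mx rc (M + const_mx (K%:R * c)).
  by apply/matrixP => i j; rewrite !mxE rmorphD rmorphM rmorph_nat.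
rewrite -[X in const_mx X](rmorph1 rc) !mapE mulr1.
case: van_h => _; apply; apply: real_point_MTD.
- move=> j; rewrite !mxE; have := uB j; rewrite ler_norml => /andP[uj _].
  have := mulr_ge0 su0 r0; move: BK; rewrite /B; lra.
- have K1 j : 1 <= (u + const_mx K%:R) j 0.
    rewrite !mxE; have := uB j; rewrite ler_norml => /andP[uj _].
    have := mulr_ge0 su0 r0; move: BK; rewrite /B; lra.
  apply: lt_le_trans (ler_sum _ (fun j _ => K1 j)).
  by rewrite sumr_const card_ord ltr0n.
- have C1 : 1 <= C by rewrite lerDl mulr_ge0.
  have K1 k : 1 <= (y + const_mx (K%:R * C)) 0 k.
    rewrite !mxE; have := yB k; rewrite ler_norml => /andP[yk _].
    have KC : K%:R <= K%:R * C by rewrite ler_peMr.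
    have := mulr_ge0 su0 r0; move: BK; rewrite /B; lra.
  apply: lt_le_trans (ler_sum _ (fun k _ => K1 k)).
  by rewrite sumr_const card_ord ltr0n.
- move=> a k; rewrite !mxE.
  have -> : \sum_j (u + const_mx K%:R) j 0 = \sum_j u j 0 + l%:R * K%:R.
    under eq_bigr do rewrite !mxE.
    by rewrite big_split sumr_const card_ord -[K%:R *+ l]mulr_natl.
  have /ler_normlP[yk1 yk2] := yB k; have /ler_normlP[r1 r2] := rC a k.
  have K0 : 0 <= K%:R :> R by [].
  have lr : 0 <= l%:R * K%:R * (r + rext w a k).
    by rewrite !mulr_ge0 //; lra.
  have ur : `|(\sum_j u j 0) * rext w a k| <= su * r.
    by rewrite normrM ler_pM // ler_norm_sum.
  have /ler_normlP[ur1 ur2] := ur.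
  move: BK; rewrite /B /C; move: lr ur1 ur2 yk1 yk2; nra.
Qed.

Lemma van_cone_point (u : 'cV[F]_l) (w : 'rV[F]_b) (y : 'rV[F]_m) :
  h.@[cone_point f g u w y 0] = 0.
Proof.
(* [h] vanishes at [Re + K Im] for all integers K, hence also for K = 'i. *)
pose re k1 k2 (M : 'M[F]_(k1, k2)) := map_mx (@complex.Re R) M.
pose im k1 k2 (M : 'M[F]_(k1, k2)) := map_mx (@complex.Im R) M.
have reim k1 k2 (M : 'M[F]_(k1, k2)) : M = map_mx rc (re _ _ M) + 'i%C *: map_mx rc (im _ _ M).
  by apply/matrixP => i j; rewrite !mxE -complexE.
have [p hp] := cone_point_curve f g h (map_mx rc (re _ _ u)) (map_mx rc (im _ _ u))
  (map_mx rc (re _ _ w)) (map_mx rc (im _ _ w)) (map_mx rc (re _ _ y)) (map_mx rc (im _ _ y)).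
suff p0 : p = 0 by rewrite (reim _ _ u) (reim _ _ w) (reim _ _ y) -hp p0 horner0.
apply: (@poly_eq0_on_nat _ _ 0) => K _; rewrite hp.
have mapE k1 k2 (M N : 'M[R]_(k1, k2)) :
    map_mx rc M + K%:R *: map_mx rc N = map_mx rc (M + K%:R *: N).
  by apply/matrixP => i j; rewrite !mxE rmorphD rmorphM rmorph_nat.
by rewrite !mapE van_real.
Qed.

End Vanishing.

Lemma MTD_barE : MTD_bar R l m = segre_cone f g.
Proof.
apply/seteqP; split.
  apply: (zariski_closure_sub (p1 := p1) (p2 := p2)) MTD_proj_sub.
  - exact: emb_mxK.
  - exact: ret_mx_emb_row.
  - exact: ret_row_emb_mx.
  - exact: emb_rowK.
move=> x [x0 [u [w [y e]]]]; split=> // t h vh.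
by rewrite e; apply: (van_cone_point vh).
Qed.

End MTDCone.

(** For [l = 1] the cone is a linear space, hence smooth, so singularities are claimed for [2 <= l].
    For [m = 1] the variety is a point, of degree 1, while the binomial is 0 once [l >= 2]. *)
Theorem corollary11 (R : realType) (l m : nat) (hl : (0 < l)%N) (hm : (0 < m)%N) :
  (exists (f : {linear 'M[R[i]]_(l, m.-1 * m.-1) -> 'rV[R[i]]_(mtd_ncoord l m)})
          (L : {vspace 'rV[R[i]]_(mtd_ncoord l m)}),
     [/\ injective f,
         \dim L = m,
         is_cone (f @` segre R[i] l (m.-1 * m.-1)) L
                 (MTD_bar R l m)
       & (3 <= m)%N -> (2 <= l)%N ->
         singular_locus (MTD_bar R l m) !=set0 /\
         singular_locus (MTD_bar R l m) = proj_linear L])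
  /\ ((2 <= m)%N \/ l = 1%N ->
      proj_degree (MTD_bar R l m) 'C(l + m.-1 ^ 2 - 2, l - 1)).
Proof.
have p1f := @emb_mxK l m hm R[i]; have p1g := @ret_mx_emb_row l m hm R[i].
have p2f := @ret_row_emb_mx l m hm R[i]; have p2g := @emb_rowK l m hm R[i].
rewrite MTD_barE //; split.
  exists (@emb_mx l m R[i]), (vertex (@emb_row l m R[i])); split.
  - exact: can_inj p1f.
  - exact: (dim_vertex p2g).
  - exact: (is_cone_segre_cone p1f p1g).
  move=> m3 l2.
  have b1 : (1 < m.-1 * m.-1)%N by move: m3; case: (m) => [|[|[|m']]].
  rewrite (singular_locus_segre_cone p1f p1g p2f p2g) //; split=> //.
  exists (emb_row l (const_mx 1)); split.
    apply/eqP => e; have := p2g (const_mx 1); rewrite e linear0.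
    by move=> /rowP/(_ (omax hm))/eqP; rewrite !mxE eq_sym oner_eq0.
  by apply/vertexP; exists (const_mx 1).
move=> ml; have [m1|m1] := ltnP 1 m.
  have b0 : (0 < m.-1 * m.-1)%N by move: m1; case: (m) => [|[|m']].
  have := proj_degree_segre_cone p1f p1g p2f p2g hl b0 hm.
  by congr (proj_degree _ 'C(_, _)); rewrite -?mulnn; lia.
(* In the remaining case [m = l = 1], truncated subtraction turns the binomial into ['C(0, 0) = 1],
   the degree of a point. *)
have em : m = 1%N by apply/eqP; rewrite eqn_leq m1.
have el : l = 1%N by case: ml => // m2; rewrite em in m2.
have -> : 'C(l + m.-1 ^ 2 - 2, l - 1) = 1%N by rewrite el em.
by apply: (proj_degree_segre_cone_point p1f p1g p2f p2g) => //; rewrite em.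
Qed.
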